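(* Let $X$ be a Banach space and $T>0$. Let $\{A_\alpha\}_{\alpha\in\mathcal I}$ be a family of operators defined on the same domain $D$, dense in $X$, such that each $A_\alpha$ is the infinitesimal generator of a $C_0$-semigroup $((T_t)_\alpha)_{t\ge 0}$ on $X$, with the uniform bound $$\|(T_t)_\alpha\|_{L(X)}\le M e^{wt},\qquad t\ge 0,\ \alpha\in\mathcal I,$$ for some $M,w>0$ (independent of $\alpha$). Let $\mathbf A$ be the coordinatewise operator $\mathbf A U=\sum_{\alpha\in\mathcal I}A_\alpha(u_\alpha)H_\alpha$. Let $B_\alpha$, $\alpha\in\mathcal I$, be bounded linear operators on $X$ and let $p>0$ be such that $$K:=\sum_{\alpha\in\mathcal I}\|B_\alpha\|_{L(X)}(2\mathbb N)^{-p\alpha/2}<\infty,$$ and let $\mathbf B\lozenge U=\sum_{\alpha\in\mathcal I}\sum_{\beta\le\alpha}B_\beta(u_{\alpha-\beta})H_\alpha$. Let $U^0=\sum_{\alpha\in\mathcal I}u^0_\alpha H_\alpha\in Dom(\mathbf A)$ satisfy $$\sum_{\alpha\in\mathcal I}\|u^0_\alpha\|_X^2(2\mathbb N)^{-p\alpha}<\infty\quad\text{and}\quad \sum_{\alpha\in\mathcal I}\|A_\alpha u^0_\alpha\|_X^2(2\mathbb N)^{-p\alpha}<\infty .$$ Let $F(t,\omega)=\sum_{\alpha\in\mathcal I}f_\alpha(t)H_\alpha(\omega)$ with $f_\alpha\in C^1([0,T],X)$ for all $\alpha\in\mathcal I$ and $$\sum_{\alpha\in\mathcal I}\Big(\sup_{t\in[0,T]}\|f_\alpha(t)\|_X+\sup_{t\in[0,T]}\|f_\alpha'(t)\|_X\Big)^2(2\mathbb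 N)^{-p\alpha}<\infty .$$ Then the stochastic Cauchy problem $$\frac{d}{dt}U(t,\omega)=\mathbf A U(t,\omega)+\mathbf B\lozenge U(t,\omega)+F(t,\omega),\quad t\in(0,T],\qquad U(0,\omega)=U^0(\omega),$$ has a unique solution $U$ in $C^1([0,T],X)\otimes(S)_{-1,-p}$.
   Context: $\mathcal I=(\mathbb N_0^{\mathbb N})_c$ is the set of sequences $\alpha=(\alpha_1,\alpha_2,\dots)$ of non-negative integers with only finitely many nonzero entries; $\mathbf 0$ is the zero multi-index; operations and order ($\beta\le\alpha$) are componentwise. $(2\mathbb N)^{\alpha}=\prod_{n\ge1}(2n)^{\alpha_n}$, and $(2\mathbb N)^{c\alpha}=\prod_n(2n)^{c\alpha_n}$ for real $c$. $\{H_\alpha\}_{\alpha\in\mathcal I}$ is the Fourier–Hermite orthogonal basis of $L^2(S'(\mathbb R),\mu)$, $\mu$ the Gaussian white noise measure: $H_\alpha(\omega)=\prod_n h_{\alpha_n}(\langle\omega,\xi_n\rangle)$ with $h_n$ the Hermite polynomials and $\xi_n$ the Hermite functions. Expansions $\sum_\alpha u_\alpha H_\alpha$ below are formal series identified with their coefficient families $(u_\alpha)_{\alpha\in\mathcal I}$ (uniqueness of the chaos expansion). For a Banach space $Y$ and $p\ge0$, $Y\otimes(S)_{-1,-p}$ is the space of expansions $U=\sum_{\alpha}u_\alpha H_\alpha$, $u_\alpha\in Y$, with $\sum_\alpha\|u_\alpha\|_Y^2(2\mathbb N)^{-p\alpha}<\infty$, and $Y\otimes(S)_{-1}=\bigcup_{p}Y\otimes(S)_{-1,-p}$.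 In particular for $Y=C^1([0,T],X)$ the norm of $u$ is $\sup_{t}\|u(t)\|_X+\sup_t\|u'(t)\|_X$. Differentiation in $t$ is carried out coefficientwise: $\frac{d}{dt}U=\sum_\alpha u_\alpha'(t)H_\alpha$. $Dom(\mathbf A)=\{U=\sum_\alpha u_\alpha H_\alpha\in X\otimes (S)_{-1}: u_\alpha\in D \text{ for all }\alpha,\ \exists p_U>0,\ \sum_\alpha\|A_\alpha u_\alpha\|_X^2(2\mathbb N)^{-p_U\alpha}<\infty\}$. A solution of the Cauchy problem is a process $U$ in $C([0,T],X)\otimes(S)_{-1}\cap C^1((0,T],X)\otimes(S)_{-1}$ with $U(0)=U^0$, $U(t)\in Dom(\mathbf A)$ for $t\in(0,T]$, satisfying the equation in $X\otimes(S)_{-1}$ for all $t\in(0,T]$, i.e. coefficientwise $u_\alpha'(t)=A_\alpha u_\alpha(t)+\sum_{\beta\le\alpha}B_\beta u_{\alpha-\beta}(t)+f_\alpha(t)$ and $u_\alpha(0)=u_\alpha^0$ for every $\alpha\in\mathcal I$. *)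

(* Defs.v *)
From HB Require Import structures.
From mathcomp Require Import all_boot all_order all_algebra finmap.
From mathcomp Require Import all_classical all_reals all_analysis.

Set Implicit Arguments.
Unset Strict Implicit.
Unset Printing Implicit Defensive.

Import Order.TTheory GRing.Theory Num.Theory.
Import numFieldNormedType.Exports.

Local Open Scope classical_set_scope.
Local Open Scope ring_scope.

(* Multi-indices.  The entry alpha_(n+1) of the sequence (alpha_1, alpha_2, ...)
   is [alpha n]. *)
Definition mindex := {fsfun nat -> nat with 0%N}.

Definition mindex_le (beta alpha : mindex) : Prop :=
  forall n : nat, (beta n <= alpha n)%N.

(* Subtraction is truncated; it is only used for [beta <= alpha]. *)
Definition mindex_sub (alpha beta : mindex) : mindex :=
  [fsfun n in finsupp alpha => (alpha n - beta n)%N | 0%N].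

Lemma mindex_subE (alpha beta : mindex) (n : nat) :
  mindex_sub alpha beta n = (alpha n - beta n)%N.
Proof.
rewrite fsfunE; case: ifPn => // /fsfun_dflt ->.
by rewrite sub0n.
Qed.

(* (2N)^(c alpha) = prod_n (2n)^(c alpha_n), with n shifted by one as above;
   indices outside the support contribute a factor 1. *)
Definition weight (R : realType) (c : R) (alpha : mindex) : R :=
  \prod_(n <- finsupp alpha) (2 * n.+1)%:R `^ (c * (alpha n)%:R).

(* [\sum_(i \in P) F i] is junk when infinitely many terms are nonzero, which
   this lemma rules out for the convolutions below. *)
Lemma finite_mindex_le (alpha : mindex) :
  finite_set [set beta | mindex_le beta alpha].
Proof.
pose m := (\max_(n <- finsupp alpha) alpha n)%N.
pose g (h : {ffun finsupp alpha -> 'I_m.+1}) : mindex :=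
  [fsfun n : finsupp alpha => (h n : nat) | 0%N].
apply: (@sub_finite_set _ _ (g @` setT)); last first.
  exact/finite_image/finite_finset.
move=> beta /= ba.
have bm n : n \in finsupp alpha -> (beta n < m.+1)%N.
  by move=> na; rewrite ltnS (leq_trans (ba n))// leq_bigmax_seq.
exists [ffun n : finsupp alpha => Ordinal (bm (val n) (valP n))] => //.
apply/fsfunP => n; rewrite /g fsfun_ffun; case: insubP => [u _ <-|na] /=.
  by rewrite ffunE.
by have := ba n; rewrite (fsfun_dflt na) leqn0 => /eqP.
Qed.

(* The space Y (x) (S)_(-1,-q), for Y = P with norm N; an expansion
   U = sum_alpha u_alpha H_alpha is identified with its family of
   coefficients. *)
Definition kondratiev (R : realType) (Y : Type) (P : set Y) (N : Y -> \bar R)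
    (q : R) : set (mindex -> Y) :=
  [set u | (forall alpha, P (u alpha)) /\
    (\esum_(alpha in [set: mindex])
       (N (u alpha) ^+ 2 * (weight (- q) alpha)%:E) < +oo)%E].

Section Banach.
Context (R : realType) (X : completeNormedModType R).

Definition kondratievX : R -> set (mindex -> X) :=
  kondratiev [set: X] (fun x => `|x|%:E).

(* Derivative relative to I: one-sided at the endpoints of an interval I. *)
Definition diffquo (u : R -> X) (t h : R) : X := h^-1 *: (u (t + h) - u t).

Definition derivable_within (I : set R) (u : R -> X) (t : R) : Prop :=
  cvg (diffquo u t h @[h --> within [set h | I (t + h)] 0^']).

Definition derive_within (I : set R) (u : R -> X) (t : R) : X :=
  lim (diffquo u t h @[h --> within [set h | I (t + h)] 0^']).

(* Elements of C(I, X) and C^1(I, X) are represented by total functions; their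
   values outside I are irrelevant. *)
Definition C0_on (I : set R) : set (R -> X) :=
  [set u | {within I, continuous u}].

Definition C1_on (I : set R) : set (R -> X) :=
  [set u | [/\ {within I, continuous u},
    (forall t, I t -> derivable_within I u t) &
    {within I, continuous (derive_within I u)}]].

Definition sup_norm (I : set R) (u : R -> X) : \bar R :=
  ereal_sup [set `|u t|%:E | t in I].

Definition C1_norm (I : set R) (u : R -> X) : \bar R :=
  (sup_norm I u + sup_norm I (derive_within I u))%E.

(* C([0,T], X) (x) (S)_(-1) *)
Definition C0_process (T : R) : set (mindex -> R -> X) :=
  [set U | exists2 q : R, 0 <= q &
    kondratiev (C0_on `[0, T]) (sup_norm `[0, T]) q U].

(* C^1((0,T], X) (x) (S)_(-1).  C^1((0,T], X) is not a Banach space; its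
   topology is that of the C^1 norms on the intervals [e,T], 0 < e < T. *)
Definition C1_process (T : R) : set (mindex -> R -> X) :=
  [set U | exists2 q : R, 0 <= q & forall e : R, 0 < e -> e < T ->
    kondratiev (C1_on `[e, T]) (C1_norm `[e, T]) q U].

Definition op_norm (L : X -> X) : \bar R :=
  ereal_sup [set `|L x|%:E | x in [set x | `|x| <= 1]].

(* C_0-semigroups; [S t] is only meaningful for t >= 0. *)
Definition C0_semigroup (S : R -> {linear X -> X}) : Prop :=
  [/\ forall t, 0 <= t -> continuous (S t),
      forall x, S 0 x = x,
      forall s t x, 0 <= s -> 0 <= t -> S (s + t) x = S s (S t x) &
      forall x, S t x @[t --> 0^'+] --> x].

(* The operator A with domain D is the infinitesimal generator of S: the graph
   of A is the set of (x, y) such that (S_h x - x) / h --> y as h --> 0+.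
   Hence D is a subspace and A is linear on D; the values of A outside D are
   irrelevant. *)
Definition is_generator (D : set X) (A : X -> X) (S : R -> X -> X) : Prop :=
  forall x y, (D x /\ A x = y) <-> h^-1 *: (S h x - x) @[h --> 0^'+] --> y.

Definition coord_op (A : mindex -> X -> X) (u : mindex -> X) : mindex -> X :=
  fun alpha => A alpha (u alpha).

Definition wick_op (B : mindex -> X -> X) (u : mindex -> X) : mindex -> X :=
  fun alpha => \sum_(beta \in [set beta | mindex_le beta alpha])
    B beta (u (mindex_sub alpha beta)).

(* Dom(A) for the coordinatewise operator A *)
Definition Dom (D : set X) (A : mindex -> X -> X) : set (mindex -> X) :=
  [set u | [/\ (exists2 q : R, 0 <= q & kondratievX q u),
    (forall alpha, D (u alpha)) &
    (exists2 q : R, 0 < q & kondratievX q (coord_op A u))]].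

Definition is_solution (T : R) (D : set X) (A B : mindex -> X -> X)
    (f : mindex -> R -> X) (u0 : mindex -> X) (U : mindex -> R -> X) : Prop :=
  [/\ C0_process T U, C1_process T U,
    (forall alpha, U alpha 0 = u0 alpha),
    (forall t, 0 < t <= T -> Dom D A (U ^~ t)) &
    (forall t, 0 < t <= T -> forall alpha,
       derive_within `]0, T] (U alpha) t =
       coord_op A (U ^~ t) alpha + wick_op B (U ^~ t) alpha + f alpha t)].

End Banach.

(* Main.v *)
(** Writing [v = u'], the problem becomes the family of integral equations
    [v_a(t) = S_a(t) y_a + int_0^t S_a(s) h_a(t - s) ds] with
    [y_a = A_a u0_a + (B <> u0)_a + f_a(0)] and [h_a = f_a' + (B <> v)_a]; the
    index [a] is coupled only through the convolution [B <>].  With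
    [b_a = |B_a|], choose a majorant [N] of the data in the weighted l^2 space
    with [b * N <= kappa N]: by Cauchy-Schwarz it is the square root of an l^1
    Neumann series applied to the squares.  In the norm
    [sup_t |v_a(t)| exp (- rate t) / N_a], with [rate] large, the integral
    operator contracts by 1/2 for all [a] at once.  This yields [v], its bound
    by a multiple of [N], hence the summability of [u = u0 + int v], and, applied
    to the difference of two solutions, uniqueness.  Integrals of Banach-valued
    functions are primitives, compared through a mean value inequality for
    right derivatives. *)

Require Import Defs.
From mathcomp Require Import all_boot all_order all_algebra finmap.
From mathcomp Require Import all_classical all_reals all_analysis.
From mathcomp Require Import ring lra.
Import Order.TTheory GRing.Theory Num.Theory.
Import numFieldNormedType.Exports.
Local Open Scope classical_set_scope.
Local Open Scope ring_scope.

Set Implicit Arguments.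
Unset Strict Implicit.
Unset Printing Implicit Defensive.

(** * Calculus for Banach-valued functions *)

(** The equation is differentiated because the C^1 norm asks for a bound on u' up to t = 0. Since u0
    lies in the domain and f is C^1, the equation for v has bounded data and meets the generator
    only in its initial value; a bound on v, together with u0, then controls both halves of the norm
    with no loss in the exponent p. The price is the converse step: u0 + int v must be shown to lie
    in the domain and to solve the original equation, which [mild_solution_generator] does from the
    definition of the generator. Each index is coupled only to smaller ones, but solving along alpha
    would leave constants depending on alpha. The inequality b * N <= kappa N closes the estimate
    for all indices with one constant. Such an N exists in the weighted l^2 because the weight is
    multiplicative: it turns b into an l^1 family and is compatible with convolution. A competing
    solution is not given in mild form and may live in another exponent q; uniqueness therefore
    differentiates s -> S(t - s) W(s), and works in the exponent max(p, q). *)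

Section Vector.
Context {R : realType}.

Definition right_derivative (X : completeNormedModType R) (G : R -> X) (t : R)
    (d : X) : Prop :=
  diffquo G t k @[k --> 0^'+] --> d.

Lemma near_at_right0 (P : R -> Prop) :
  (\forall k \near 0^'+, P k) <-> exists2 e : R, 0 < e & forall k, 0 < k < e -> P k.
Proof.
split.
  move=> [e /= e0 he]; exists e => // k /andP[k0 ke]; apply: he => //=.
  by rewrite sub0r normrN gtr0_norm.
move=> [e e0 he]; exists e => //= k /=; rewrite sub0r normrN => ke k0.
by apply: he; rewrite k0 (le_lt_trans _ ke)// ler_norm.
Qed.

Lemma right_derivativeP (X : completeNormedModType R) (G : R -> X) (t : R)
    (d : X) :
  right_derivative G t d <->
  forall e, 0 < e -> \forall k \near 0^'+, `|G (t + k) - G t - k *: d| <= e * k.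
Proof.
split=> [/cvgrPdist_le H e /H{H} [r /= r0 Hr]|H].
  exists r => //= k /= kr k0; have := Hr _ kr k0.
  rewrite /diffquo => H; rewrite -distrC.
  have -> : k *: d - (G (t + k) - G t) =
            k *: (d - k^-1 *: (G (t + k) - G t)).
    by rewrite [RHS]scalerBr scalerA divff ?scale1r// gt_eqF.
  by rewrite normrZ (gtr0_norm k0) mulrC ler_pM2r.
apply/cvgrPdist_le => e /H {H} [r /= r0 Hr].
exists r => //= k /= kr k0; have H := Hr _ kr k0.
rewrite /diffquo.
have -> : d - k^-1 *: (G (t + k) - G t) =
          k^-1 *: (k *: d - (G (t + k) - G t)).
  by rewrite [RHS]scalerBr scalerA mulVf ?scale1r// gt_eqF.
rewrite normrZ gtr0_norm ?invr_gt0// distrC mulrC ler_pdivrMr//.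
Qed.

(** Continuous induction: the last point at which the estimate, loosened by [e], holds cannot lie
    before [b], since the right derivatives carry it a little further. Right derivatives are what
    the definition of a generator provides. *)
Lemma mean_value_ineq (X : completeNormedModType R) (G g : R -> X)
    (phi psi : R -> R^o) (a b : R) : a <= b ->
  continuous G -> continuous phi ->
  (forall t, a < t < b -> right_derivative G t (g t)) ->
  (forall t, a < t < b -> right_derivative phi t (psi t)) ->
  (forall t, a < t < b -> `|g t| <= psi t) ->
  `|G b - G a| <= phi b - phi a.
Proof.
move=> ab cG cphi dG dphi gpsi.
suff slack e : 0 < e -> `|G b - G a| <= phi b - phi a + e * (b - a + 1).
  apply/ler_addgt0Pr => e e0.
  have ba : 0 < b - a + 1 by rewrite ltr_wpDl// subr_ge0.
  by have := slack _ (divr_gt0 e0 ba); rewrite divfK// lt0r_neq0.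
move=> e0.
(* The slope [e] absorbs the two first-order errors of size [e / 2 * k]; the extra [+ 1] makes
   [r a = e > 0], so that continuity alone leads past [a], where no derivative is assumed. *)
pose r t : R := phi t - phi a + e * (t - a + 1) - `|G t - G a|.
have cr : continuous r.
  move=> t; apply: cvgB; last first.
    by apply: cvg_norm; apply: cvgB; [exact: cG|exact: cvg_cst].
  apply: cvgD.
    by apply: cvgB; [exact: cphi|exact: cvg_cst].
  apply: cvgMr; apply: cvgD; last exact: cvg_cst.
  by apply: cvgB; [exact: cvg_id|exact: cvg_cst].
have ra : r a = e by rewrite /r !subrr normr0 add0r subr0 add0r mulr1.
rewrite -subr_ge0 -/(r b) leNgt; apply/negP => rb.
pose E := [set t | a <= t <= b /\ 0 <= r t].
have Ea : E a by split; [rewrite lexx ab|rewrite ra ltW].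
have supE : has_sup E.
  by split; [exists a|exists b => t [/andP[]]].
have EsupE : E (sup E).
  have cE : closed E.
    rewrite (_ : E = `[a, b]%classic `&` r @^-1` [set x | 0 <= x]).
      apply: closedI; first exact: itv_closed.
      by apply: preimage_closed => //; exact: closed_ge.
    by apply/seteqP; split=> t /=; rewrite in_itv.
  by apply: cE; apply: closure_sup => //; [exists a|case: supE].
have noE k : 0 < k -> ~ E (sup E + k).
  move=> k0 /(ub_le_sup (proj2 supE)); rewrite gerDl leNgt k0//.
set c := sup E in EsupE noE; have [/andP[ac cb] rc] := EsupE.
have {}cb : c < b.
  by rewrite lt_neqAle cb andbT; apply: contraTneq rb => <-; rewrite -leNgt.
suff [k k0 kE] : exists2 k, 0 < k & E (c + k) by exact: noE kE.
have cbk : \forall k \near 0^'+, c + k <= b.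
  apply/near_at_right0; exists (b - c); first by rewrite subr_gt0.
  by move=> k /andP[_]; rewrite ltrBrDl => /ltW.
suff rk : \forall k \near 0^'+, 0 <= r (c + k).
  have /near_at_right0[d d0 Hd] : \forall k \near 0^'+, E (c + k) /\ 0 < k.
    near=> k; split=> //; split; last by near: k.
    apply/andP; split; last by near: k.
    by rewrite (le_trans ac)// lerDl.
  by exists (d / 2); [rewrite divr_gt0|apply: (Hd _ _).1; lra].
move: ac; rewrite le_eqVlt => /predU1P[ac|ac].
  have : \forall x \near c, 0 < r x.
    by apply: (cvgr_gt _ (cr c)); rewrite -ac ra.
  move=> [d /= d0 Hd]; apply/near_at_right0; exists d => // k /andP[k0 kd].
  by apply/ltW/Hd => /=; rewrite opprD addrA subrr sub0r normrN gtr0_norm.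
have acb : a < c < b by rewrite ac cb.
have e20 : 0 < e / 2 by rewrite divr_gt0.
near=> k.
have k0 : 0 < k by [].
have : `|G (c + k) - G c - k *: g c| <= e / 2 * k.
  by near: k; apply: (iffLR (right_derivativeP _ _ _)) => //; exact: dG.
have : `|phi (c + k) - phi c - k * psi c| <= e / 2 * k.
  by near: k; apply: (iffLR (right_derivativeP _ _ _)) => //; exact: dphi.
move=> /ler_normlP[+ _] Gk.
have : `|G (c + k) - G a| <= `|G c - G a| + (e / 2 * k + k * psi c).
  rewrite (_ : G (c + k) - G a = G c - G a +
    ((G (c + k) - G c - k *: g c) + k *: g c)); last first.
    by rewrite subrK [RHS]addrC addrA subrK.
  rewrite (le_trans (ler_normD _ _))// lerD2l (le_trans (ler_normD _ _))//.
  by rewrite lerD// normrZ (gtr0_norm k0) ler_pM2l// gpsi.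
move: rc; rewrite /r; lra.
Unshelve. all: by end_near.
Qed.

End Vector.

(** * Existence of primitives of continuous Banach-valued functions *)

Section Primitive.
Context {R : realType}.

Definition derivative (X : completeNormedModType R) (G : R -> X) (t : R)
    (d : X) : Prop :=
  diffquo G t k @[k --> 0^'] --> d.

Lemma derivativeP (X : completeNormedModType R) (G : R -> X) (t : R) (d : X) :
  derivative G t d <->
  forall e, 0 < e -> \forall k \near 0, `|G (t + k) - G t - k *: d| <= e * `|k|.
Proof.
split=> [/cvgrPdist_le H e /H{H} [r /= r0 Hr]|H].
  exists r => //= k /= kr; have [->|k0] := eqVneq k 0.
    by rewrite addr0 subrr scale0r subrr !normr0 mulr0.
  have {Hr} := Hr _ kr k0; rewrite /diffquo => H; rewrite -distrC.
  have -> : k *: d - (G (t + k) - G t) =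
            k *: (d - k^-1 *: (G (t + k) - G t)).
    by rewrite [RHS]scalerBr scalerA divff ?scale1r.
  by rewrite normrZ mulrC ler_pM2r ?normr_gt0.
apply/cvgrPdist_le => e /H {H} [r /= r0 Hr].
exists r => //= k /= kr k0; have {Hr} H := Hr _ kr.
rewrite /diffquo.
have -> : d - k^-1 *: (G (t + k) - G t) =
          k^-1 *: (k *: d - (G (t + k) - G t)).
  by rewrite [RHS]scalerBr scalerA mulVf ?scale1r.
by rewrite normrZ normfV distrC mulrC ler_pdivrMr ?normr_gt0.
Qed.

Lemma derivative_right (X : completeNormedModType R) (G : R -> X) (t : R)
    (d : X) :
  derivative G t d -> right_derivative G t d.
Proof.
move=> H; apply: cvg_trans H; apply: cvg_app.
by move=> A [e /= e0 HA]; exists e => //= k ke k0; apply: HA => //; rewrite gt_eqF.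
Qed.

Lemma derivative_continuous (X : completeNormedModType R) (G : R -> X) (t : R)
    (d : X) :
  derivative G t d -> {for t, continuous G}.
Proof.
move=> /derivativeP/(_ _ ltr01) [r /= r0 Hr].
apply/cvgrPdist_le => e e0.
have d0 : 0 < 1 + `|d| by rewrite ltr_pwDl.
exists (Num.min r (e / (1 + `|d|))) => [|x] /=.
  by rewrite lt_min r0 divr_gt0.
rewrite lt_min => /andP[xr xe].
have := Hr (x - t); rewrite /= sub0r normrN distrC => /(_ xr).
rewrite [t + _]addrC subrK mul1r => H.
rewrite distrC (_ : G x - G t =
  (G x - G t - (x - t) *: d) + (x - t) *: d); last by rewrite subrK.
rewrite (le_trans (ler_normD _ _))// normrZ.
apply: le_trans (_ : `|x - t| * (1 + `|d|) <= _).
  by rewrite mulrDr mulr1 lerD2r [leRHS]distrC.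
by rewrite -ler_pdivlMr// distrC ltW.
Qed.

(** Compactness of the segment. Only [s] is confined to it: [continuous_duhamel] applies this with a
    second point that may be negative. *)
Lemma uniform_continuity (X : completeNormedModType R) (h : R -> X) (a b e : R) :
  continuous h -> 0 < e ->
  exists2 d : R, 0 < d &
    forall s t, a <= s <= b -> `|s - t| < d -> `|h s - h t| <= e.
Proof.
move=> ch e0.
have /compact_near_coveringP cab := @segment_compact R a b.
have [] := @cab R (0^'+) (fun d s => forall t, `|s - t| < d -> `|h s - h t| <= e).
  move=> x _.
  have /cvgrPdist_lt/(_ _ (divr_gt0 e0 (ltr0Sn _ 1))) [r /= r0 Hr] := ch x.
  exists (ball x (r / 2), [set d | d < r / 2]) => /=.
    split; first by apply: nbhsx_ballx; rewrite divr_gt0.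
    by apply/near_at_right0; exists (r / 2); [rewrite divr_gt0|move=> k /andP[]].
  move=> [s d] [/= xs dr] t st.
  rewrite (_ : h s - h t = (h s - h x) + (h x - h t)); last first.
    by rewrite addrA subrK.
  rewrite (le_trans (ler_normD _ _))// [e]splitr lerD//.
    by rewrite distrC ltW// Hr//=; apply: lt_le_trans xs _; lra.
  apply/ltW/Hr => /=; rewrite (_ : x - t = (x - s) + (s - t)); last first.
    by rewrite addrA subrK.
  by rewrite (le_lt_trans (ler_normD _ _))// [r]splitr ltrD// (lt_trans st).
move=> r /= r0 Hr; exists (r / 2); first by rewrite divr_gt0.
move=> s t sab; apply: (Hr (r / 2)) => //=.
- by rewrite sub0r normrN gtr0_norm ?divr_gt0//; lra.
- by rewrite divr_gt0.
Qed.

(** The bound passes to the limit, which gives convergence with an explicit error. The threshold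
    [n0] serves sequences estimated only from some index on, such as the approximate primitives at
    [t], controlled once [n.+1 >= |t|]. *)
Lemma cauchy_rate (X : completeNormedModType R) (u : nat -> X) (r : nat -> R)
    (n0 : nat) :
  r @ \oo --> 0 ->
  (forall n m, (n0 <= n)%N -> (n <= m)%N -> `|u m - u n| <= r n) ->
  exists2 l, u @ \oo --> l & forall n, (n0 <= n)%N -> `|l - u n| <= r n.
Proof.
move=> r0 ur.
have /cvg_ex[l ul] : cvg (u @ \oo).
  apply: cauchy_cvg; apply: cauchy_exP => e e0.
  have /cvgrPdist_lt/(_ _ e0) [N _ HN] := r0.
  pose n := maxn n0 N; exists (u n); exists n => //= m /= nm.
  rewrite -ball_normE/= distrC (le_lt_trans (ur _ _ _ nm))// ?leq_maxl//.
  have := HN n; rewrite /= sub0r normrN leq_maxr => /(_ isT).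
  by apply: le_lt_trans; exact: ler_norm.
exists l => // n nn0.
have : `|u m - u n| @[m --> \oo] --> `|l - u n|.
  by apply: cvg_norm; apply: cvgB => //; exact: cvg_cst.
move=> H; apply: (cvgr_to_le H); exists n => // m /= nm; exact: ur.
Qed.

(** Subdividing into steps shorter than [d] and telescoping loses nothing in the constant. Two
    approximate primitives can thus be compared although their common scale [d] depends on both. *)
Lemma locally_lipschitz_segment (X : completeNormedModType R) (H : R -> X)
    (a b d C : R) : a <= b -> 0 < d ->
  (forall s t, a <= s -> s <= t -> t <= b -> t - s < d ->
    `|H t - H s| <= C * (t - s)) ->
  `|H b - H a| <= C * (b - a).
Proof.
move=> ab d0 lip.
pose N := (Num.trunc ((b - a) / d)).+1.
have N0 : 0 < N%:R :> R by rewrite ltr0n.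
have step : (b - a) / N%:R < d.
  by rewrite ltr_pdivrMr// -ltr_pdivrMl// mulrC; exact: truncnS_gt.
pose x k : R := a + k%:R * ((b - a) / N%:R).
have x0 : 0 <= (b - a) / N%:R by rewrite divr_ge0// subr_ge0.
have xN : x N = b by rewrite /x mulrC divfK ?lt0r_neq0// addrC subrK.
have xS k : x k.+1 = x k + (b - a) / N%:R by rewrite /x -natr1 mulrDl mul1r addrA.
have xle k : (k <= N)%N -> x k <= b.
  by move=> kN; rewrite -xN /x lerD2l ler_wpM2r// ler_nat.
have ax k : a <= x k by rewrite lerDl mulr_ge0.
suff Hk k : (k <= N)%N -> `|H (x k) - H a| <= C * (x k - a).
  by have := Hk _ (leqnn N); rewrite xN.
elim: k => [_|k IH kN].
  by rewrite /x mul0r addr0 !subrr normr0 mulr0.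
rewrite (_ : H _ - _ = (H (x k.+1) - H (x k)) + (H (x k) - H a)); last first.
  by rewrite addrA subrK.
rewrite (le_trans (ler_normD _ _))//.
rewrite (_ : C * _ = C * (x k.+1 - x k) + C * (x k - a)); last by ring.
apply: lerD; last by apply: IH; rewrite ltnW.
by apply: lip; rewrite ?xle// xS ?lerDl// addrAC subrr add0r.
Qed.

(** The base point [r] is free in [[s, t]], so that [r = s] and [r = t] give the right and the left
    difference quotient. The window [[- L, L]] will grow with the accuracy. *)
Definition approx_primitive (X : completeNormedModType R) (h : R -> X) (L e : R)
    (G : R -> X) : Prop :=
  exists2 d, 0 < d & forall s r t, - L <= s -> s <= r -> r <= t -> t <= L ->
    t - s < d -> `|G t - G s - (t - s) *: h r| <= e * (t - s).

(* The primitive of a step function approximating [h]. *)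
Lemma approx_primitive_exists (X : completeNormedModType R) (h : R -> X)
    (L e : R) : continuous h -> 0 < L -> 0 < e ->
  exists2 G, G 0 = 0 & approx_primitive h L e G.
Proof.
move=> ch L0 e0.
have [d d0 Hd] := uniform_continuity (- L) L ch e0.
pose N := (Num.trunc (2 * L / (d / 2))).+1.
pose x k : R := - L + k%:R * (d / 2).
have d20 : 0 < d / 2 by rewrite divr_gt0.
have xN : L <= x N.
  have : 2 * L / (d / 2) < N%:R by exact: truncnS_gt.
  by rewrite ltr_pdivrMr// /x; lra.
have x0 : x 0 = - L by rewrite /x mul0r addr0.
have xS k : x k.+1 = x k + d / 2 by rewrite /x -natr1 mulrDl mul1r addrA.
(* [c k t] is the length of the part of the cell [[x k, x k.+1]] to the left of [t]: these lengths
   add up to [t + L], and between [s] and [t] only cells that meet [[s, t]] contribute. *)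
pose c k t : R := Num.min t (x k.+1) - Num.min t (x k).
have sumc t : - L <= t <= L -> \sum_(0 <= k < N) c k t = t + L.
  move=> /andP[Lt tL]; rewrite (telescope_sumr (fun k => Num.min t (x k)))//.
  by rewrite x0 (min_idPl _) ?(le_trans tL)// (min_idPr Lt) opprK.
have cnd k s t : s <= t -> 0 <= c k t - c k s.
  move=> st; rewrite /c xS; move: (x k) => y.
  by rewrite /Num.min; do ![case: ltP => ?]; lra.
have csupp k s t : s <= t -> c k t - c k s != 0 -> x k < t /\ s < x k.+1.
  move=> st cts; split; rewrite ltNge; apply: contra cts => le.
    rewrite /c !(min_idPl _) ?subrr ?xS//; lra.
  rewrite /c !(min_idPr _) ?subrr ?xS//; move: le; rewrite xS; lra.
pose G t : X := \sum_(0 <= k < N) c k t *: h (x k).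
exists (fun t => G t - G 0); first by rewrite subrr.
(* The mesh is [d / 2] and [t - s < d / 2], so a contributing node [x k] lies within [d] of [r]. *)
exists (d / 2) => // s r t Ls sr rt tL tsd.
have -> : G t - G 0 - (G s - G 0) - (t - s) *: h r =
    \sum_(0 <= k < N) (c k t - c k s) *: (h (x k) - h r).
  rewrite opprB addrA subrK.
  rewrite (_ : t - s = (t + L) - (s + L)); last by ring.
  rewrite -!sumc; last 2 first.
  - by rewrite Ls (le_trans (le_trans sr rt)).
  - by rewrite tL (le_trans Ls (le_trans sr rt)).
  rewrite -!sumrB scaler_suml -sumrB; apply: eq_bigr => k _.
  by rewrite -scalerBl -scalerBr.
have -> : e * (t - s) = \sum_(0 <= k < N) (c k t - c k s) * e.
  by rewrite -mulr_suml sumrB !sumc//; first ring; apply/andP; split; lra.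
rewrite (le_trans (ler_norm_sum _ _ _))// ler_sum// => k _.
have st := le_trans sr rt.
rewrite normrZ ger0_norm ?cnd//.
have [->|/csupp] := eqVneq (c k t - c k s) 0; first by rewrite !mul0r.
move=> /(_ st)[xt sx]; rewrite ler_wpM2l ?cnd// distrC Hd//.
  by rewrite (le_trans Ls sr) (le_trans rt tL).
by move: sx; rewrite xS ltr_norml; lra.
Qed.

(** The differences [G m - G n] are Lipschitz with constant [2 / n.+1] on the window of [G n]. This
    gives convergence and, in the limit, compares the increments of [g] with those of [G n];
    pointwise closeness would say nothing about derivatives. *)
Lemma primitive_exists (X : completeNormedModType R) (h : R -> X) :
  continuous h -> exists2 G, G 0 = 0 & forall t, derivative G t (h t).
Proof.
move=> ch.
have /choice[G GP] : forall n : nat, exists G,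
    G 0 = 0 /\ approx_primitive h n.+1%:R n.+1%:R^-1 G.
  move=> n; have [||G ? ?] := @approx_primitive_exists X h n.+1%:R n.+1%:R^-1 ch.
  - by [].
  - by rewrite invr_gt0.
  - by exists G.
have cmp n m (L a b : R) : (n <= m)%N -> L <= n.+1%:R -> - L <= a -> a <= b -> b <= L ->
    `|(G m b - G n b) - (G m a - G n a)| <= 2 * n.+1%:R^-1 * (b - a).
  move=> nm Ln La ab bL.
  have [_ [d d0 Hd]] := GP n; have [_ [d' d'0 Hd']] := GP m.
  apply: (@locally_lipschitz_segment X (fun t => G m t - G n t) a b
    (Num.min d d')) => //.
    by rewrite lt_min d0.
  move=> s t sa st tb; rewrite lt_min => /andP[sd sd'].
  have nm' : n.+1%:R <= m.+1%:R :> R by rewrite ler_nat.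
  have {}Hd : `|G n t - G n s - (t - s) *: h s| <= n.+1%:R^-1 * (t - s).
    by apply: Hd => //; lra.
  have {}Hd' : `|G m t - G m s - (t - s) *: h s| <= n.+1%:R^-1 * (t - s).
    apply: (@le_trans _ _ (m.+1%:R^-1 * (t - s))).
      by apply: Hd' => //; lra.
    by rewrite ler_wpM2r ?subr_ge0// lef_pV2 ?posrE.
  rewrite (_ : _ - _ - _ = (G m t - G m s - (t - s) *: h s) -
      (G n t - G n s - (t - s) *: h s)); last first.
    by rewrite [in RHS]opprB [in RHS]addrA subrK !opprD addrACA.
  by rewrite (le_trans (ler_normB _ _))// -mulrA mulr_natl mulr2n lerD.
have r0 (C : R) : 2 * n.+1%:R^-1 * C @[n --> \oo] --> (0 : R).
  have -> : (0 : R) = 2 * 0 * C by rewrite mulr0 mul0r.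
  by apply: cvgMl; apply: cvgMr; exact: cvg_harmonic.
have G0 n : G n 0 = 0 by have [] := GP n.
have lim t : exists l : X, G n t @[n --> \oo] --> l.
  have [] := @cauchy_rate X (G ^~ t) (fun n => 2 * n.+1%:R^-1 * `|t|)
    (Num.trunc `|t|).+1 (r0 _); last by move=> l ? _; exists l.
  move=> n m tn nm.
  have tn' : `|t| <= n.+1%:R.
    by apply/ltW/(lt_trans (truncnS_gt _)); rewrite ltr_nat.
  have [t0|t0] := lerP 0 t.
    have := @cmp n m `|t| 0 t nm tn'; rewrite !G0 !subrr !subr0 (ger0_norm t0).
    by apply; rewrite // oppr_le0.
  have := @cmp n m `|t| t 0 nm tn'; rewrite !G0 !subrr !sub0r normrN.
  by rewrite (ltr0_norm t0) opprK; apply; rewrite ?oppr_ge0 // ltW.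
have /choice[g gP] := lim.
exists g.
  have := gP 0; rewrite (_ : (fun n => G n 0) = cst 0); last exact/funext.
  by move=> /(cvg_unique (@norm_hausdorff _ _)); apply; exact: cvg_cst.
have gcmp n (L a b : R) : L <= n.+1%:R -> - L <= a -> a <= b -> b <= L ->
    `|(g b - G n b) - (g a - G n a)| <= 2 * n.+1%:R^-1 * (b - a).
  move=> Ln La ab bL.
  have : `|(G m b - G n b) - (G m a - G n a)| @[m --> \oo] -->
         `|(g b - G n b) - (g a - G n a)|.
    by apply: cvg_norm; apply: cvgB; apply: cvgB; [exact: gP|exact: cvg_cst|
      exact: gP|exact: cvg_cst].
  move=> H; apply: (cvgr_to_le H); exists n => // m /= nm.
  exact: (@cmp n m L).
move=> t; apply/derivativeP => e e0.
(* The window of [G n] contains [[t - 1, t + 1]], and [3 / n.+1 <= e] pays for the Lipschitz error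
   [2 / n.+1] and for the error [1 / n.+1] of [G n] itself. *)
pose n := maxn (Num.trunc (`|t| + 1)) (Num.trunc (3 * e^-1)).
have nt : `|t| + 1 <= n.+1%:R.
  by apply/ltW/(lt_le_trans (truncnS_gt _)); rewrite ler_nat ltnS leq_maxl.
have ne : 3 * n.+1%:R^-1 <= e.
  rewrite ler_pdivrMr// mulrC -ler_pdivrMr//.
  by apply/ltW/(lt_le_trans (truncnS_gt _)); rewrite ler_nat ltnS leq_maxr.
have [_ [d d0 Hd]] := GP n.
have key s r u : - (`|t| + 1) <= s -> s <= r -> r <= u -> u <= `|t| + 1 ->
    u - s < d -> `|g u - g s - (u - s) *: h r| <= e * (u - s).
  move=> ts sr ru ut usd.
  rewrite (_ : _ - _ - _ = ((g u - G n u) - (g s - G n s)) +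
     (G n u - G n s - (u - s) *: h r)); last first.
    rewrite addrA; congr (_ - _); rewrite opprB -[RHS]addrA.
    by rewrite [G n s - _ + _]addrC [G n u - _ + _]addrA subrK addrA subrK.
  rewrite (le_trans (ler_normD _ _))//.
  have su := le_trans sr ru.
  apply: (@le_trans _ _ (3 * n.+1%:R^-1 * (u - s))); last first.
    by rewrite ler_wpM2r// subr_ge0.
  rewrite (_ : 3 * _ * _ = 2 * n.+1%:R^-1 * (u - s) + n.+1%:R^-1 * (u - s)); last by ring.
  apply: lerD; first by apply: (gcmp n (`|t| + 1)).
  by apply: Hd => //; lra.
exists (Num.min 1 d) => /=; first by rewrite lt_min ltr01.
move=> k /=; rewrite sub0r normrN lt_min => /andP[k1 kd].
have := ler_norm t; have := ler_norm (- t); rewrite normrN => t1 t2.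
have := ler_norm k; have := ler_norm (- k); rewrite normrN => k2 k3.
have [k0|k0] := lerP 0 k.
  have := key t t (t + k); rewrite [t + k]addrC addrK.
  by rewrite (ger0_norm k0) in k1 kd *; apply; lra.
have := key (t + k) t t; rewrite (_ : t - (t + k) = - k); last by ring.
rewrite (ltr0_norm k0) in k1 kd *.
rewrite scaleNr opprK => H.
rewrite (_ : _ - _ - _ = - (g t - g (t + k) + k *: h t)); last first.
  by rewrite opprD opprB.
by rewrite normrN; apply: H; lra.
Qed.

End Primitive.

(** * Rules for right derivatives and integrals *)

Section PrimitiveCalculus.
Context {R : realType}.
Implicit Types X Y : completeNormedModType R.

(** The integral from 0 to t, signed for negative t. The default [cst 0] is taken when [h] has no
    primitive on the whole line, so integrands are first extended to continuous functions on R. *)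
Definition primitive X (h : R -> X) : R -> X :=
  xget (cst 0) [set G | G 0 = 0 /\ forall t, derivative G t (h t)].

Lemma primitiveP X (h : R -> X) : continuous h ->
  primitive h 0 = 0 /\ forall t, derivative (primitive h) t (h t).
Proof.
move=> /primitive_exists[G G0 dG].
by apply: (@xgetPex _ (cst 0) [set G | G 0 = 0 /\ _]); exists G.
Qed.

Lemma primitive0 X (h : R -> X) : continuous h -> primitive h 0 = 0.
Proof. by move=> /primitiveP[]. Qed.

Lemma derivative_primitive X (h : R -> X) t : continuous h ->
  derivative (primitive h) t (h t).
Proof. by move=> /primitiveP[]. Qed.

Lemma right_derivative_primitive X (h : R -> X) t : continuous h ->
  right_derivative (primitive h) t (h t).
Proof. by move=> ch; apply/derivative_right/derivative_primitive. Qed.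

Lemma continuous_primitive X (h : R -> X) : continuous h ->
  continuous (primitive h).
Proof.
move=> ch t; apply: (@derivative_continuous _ _ _ _ (h t)).
exact: derivative_primitive.
Qed.

Lemma right_derivative_cst X (x : X) t : right_derivative (cst x) t 0.
Proof.
apply/right_derivativeP => e e0; apply/near_at_right0; exists 1 => // k /andP[k0 _].
by rewrite /= subrr scaler0 subrr normr0 mulr_ge0// ltW.
Qed.

Lemma right_derivativeD X (F G : R -> X) t x y : right_derivative F t x ->
  right_derivative G t y -> right_derivative (fun s => F s + G s) t (x + y).
Proof.
move=> dF dG; rewrite /right_derivative (_ : diffquo _ t =
  (fun k => diffquo F t k + diffquo G t k)); first exact: cvgD.
by apply/funext => k; rewrite /diffquo opprD addrACA scalerDr.
Qed.

Lemma right_derivativeN X (F : R -> X) t x : right_derivative F t x ->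
  right_derivative (fun s => - F s) t (- x).
Proof.
move=> dF; rewrite /right_derivative (_ : diffquo _ t =
  (fun k => - diffquo F t k)); first exact: cvgN.
by apply/funext => k; rewrite /diffquo -opprD scalerN.
Qed.

Lemma right_derivativeB X (F G : R -> X) t x y : right_derivative F t x ->
  right_derivative G t y -> right_derivative (fun s => F s - G s) t (x - y).
Proof. by move=> dF dG; apply/right_derivativeD/right_derivativeN. Qed.

Lemma right_derivative_sum X (I : Type) (r : seq I) (F : I -> R -> X) (x : I -> X) t :
  (forall i, right_derivative (F i) t (x i)) ->
  right_derivative (fun s => \sum_(i <- r) F i s) t (\sum_(i <- r) x i).
Proof.
move=> dF; elim: r => [|i r IH].
  rewrite big_nil (_ : (fun s => _) = cst 0); first exact: right_derivative_cst.
  by apply/funext => s; rewrite big_nil.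
rewrite big_cons (_ : (fun s => _) = (fun s => F i s + \sum_(j <- r) F j s)).
  exact: right_derivativeD.
by apply/funext => s; rewrite big_cons.
Qed.

Lemma right_derivative_shift X (F : R -> X) a t x :
  right_derivative F (a + t) x -> right_derivative (fun s => F (a + s)) t x.
Proof.
rewrite /right_derivative (_ : diffquo (fun s => F (a + s)) t =
  diffquo F (a + t))//.
by apply/funext => k; rewrite /diffquo addrA.
Qed.

Lemma right_derivative_linear X (L : {linear X -> X}) (F : R -> X) t x :
  continuous L -> right_derivative F t x ->
  right_derivative (fun s => L (F s)) t (L x).
Proof.
move=> cL dF; rewrite /right_derivative (_ : diffquo _ t = L \o diffquo F t).
  by apply: continuous_cvg; [exact: cL|exact: dF].
by apply/funext => k; rewrite /diffquo /= linearZ_LR (raddfB L).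
Qed.

Lemma right_derivative_scale X (x : X) t : right_derivative (fun s : R => s *: x) t x.
Proof.
apply/right_derivativeP => e e0; apply/near_at_right0; exists 1 => // k /andP[k0 _].
by rewrite -!scalerBl addrAC addrK subrr scale0r normr0 mulr_ge0// ltW.
Qed.

Lemma right_derivative_is_derive (phi : R -> R^o) (t d : R) :
  is_derive t 1 phi d -> right_derivative phi t d.
Proof.
move=> [dphi <-]; apply: derivative_right.
rewrite /derivative (_ : diffquo phi t =
  fun h => h^-1 *: ((phi \o shift t) (h *: 1%R) - phi t)).
  exact: dphi.
by apply/funext => k; rewrite /diffquo /= [k *: _]mulr1 [k + t]addrC.
Qed.

(** The difference has right derivative 0, so the mean value inequality applies with a zero
    majorant. This plays the part of the fundamental theorem of calculus: identities between
    integrals are proved below by differentiating both sides. *)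
Lemma primitive_unique X (G h : R -> X) t : 0 <= t ->
  continuous G -> continuous h ->
  (forall s, 0 < s < t -> right_derivative G s (h s)) ->
  G t = G 0 + primitive h t.
Proof.
move=> t0 cG ch dG.
have := @mean_value_ineq R X (fun s => G s - primitive h s) (cst 0) (cst 0)
  (cst 0) 0 t t0.
rewrite primitive0// subr0 subrr => H.
suff : `|G t - primitive h t - G 0| <= 0.
  rewrite normr_le0 subr_eq0 subr_eq => /eqP ->; by [].
apply: H.
- by move=> s; apply: cvgB; [exact: cG|exact: continuous_primitive].
- by move=> s; exact: cvg_cst.
- move=> s st; rewrite /= -(subrr (h s)); apply: right_derivativeB; first exact: dG.
  exact: right_derivative_primitive.
- by move=> s _; exact: (@right_derivative_cst R^o).
- by move=> s _; rewrite /= normr0.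
Qed.

Lemma primitive_le X (h : R -> X) (phi psi : R -> R^o) (a b : R) : a <= b ->
  continuous h -> continuous phi ->
  (forall t, a < t < b -> right_derivative phi t (psi t)) ->
  (forall t, a < t < b -> `|h t| <= psi t) ->
  `|primitive h b - primitive h a| <= phi b - phi a.
Proof.
move=> ab ch cphi dphi hpsi.
apply: (@mean_value_ineq R X _ h _ psi) => //.
  exact: continuous_primitive.
by move=> t _; exact: right_derivative_primitive.
Qed.

Lemma mean_value_ineq_cst X (G g : R -> X) (a b C : R) : a <= b ->
  continuous G -> (forall t, a < t < b -> right_derivative G t (g t)) ->
  (forall t, a < t < b -> `|g t| <= C) -> `|G b - G a| <= C * (b - a).
Proof.
move=> ab cG dG gC.
have := @mean_value_ineq R X G g (fun s => s *: (C : R^o)) (cst C) a b ab cG.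
rewrite -scalerBl [_ *: _]mulrC; apply => //.
- by move=> t; apply: cvgZr_tmp; exact: cvg_id.
- by move=> t _; exact: right_derivative_scale.
Qed.

Lemma primitive_lipschitz X (h : R -> X) (a b C : R) : a <= b ->
  continuous h -> (forall t, a < t < b -> `|h t| <= C) ->
  `|primitive h b - primitive h a| <= C * (b - a).
Proof.
move=> ab ch hC; apply: (@mean_value_ineq_cst X _ h) => //.
  exact: continuous_primitive.
by move=> t _; exact: right_derivative_primitive.
Qed.

Lemma primitiveB X (h k : R -> X) t : 0 <= t -> continuous h -> continuous k ->
  primitive (fun s => h s - k s) t = primitive h t - primitive k t.
Proof.
move=> t0 ch ck.
have /(_ _ _) := @primitive_unique X (fun s => primitive h s - primitive k s)
  (fun s => h s - k s) t t0.
rewrite !primitive0// subrr add0r => -> //.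
- by move=> s; apply: cvgB; exact: continuous_primitive.
- by move=> s; apply: cvgB; [exact: ch|exact: ck].
- by move=> s _; apply: right_derivativeB; exact: right_derivative_primitive.
Qed.

Lemma primitive_linear X (L : {linear X -> X}) (h : R -> X) t : 0 <= t ->
  continuous L -> continuous h ->
  primitive (fun s => L (h s)) t = L (primitive h t).
Proof.
move=> t0 cL ch.
have := @primitive_unique X (fun s => L (primitive h s)) (fun s => L (h s)) t t0.
rewrite primitive0// linear0 add0r => -> //.
- by move=> s; apply: continuous_cvg; [exact: cL|exact: continuous_primitive].
- by move=> s; apply: continuous_cvg; [exact: cL|exact: ch].
- by move=> s _; apply: right_derivative_linear => //; exact: right_derivative_primitive.
Qed.

Lemma bounded_on_segment X (h : R -> X) (a b : R) : continuous h ->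
  exists2 C, 0 <= C & forall s, a <= s <= b -> `|h s| <= C.
Proof.
move=> ch; have [ab|ba] := leP a b; last first.
  exists 0 => // s /andP[as_ sb]; have := lt_le_trans ba (le_trans as_ sb).
  by rewrite ltxx.
have cn : {within `[a, b], continuous (fun s => `|h s|)}.
  by apply: continuous_subspaceT => s; apply: cvg_norm; exact: ch.
have [c _ Hc] := EVT_max ab cn; by exists `|h c|.
Qed.

End PrimitiveCalculus.

(** * Strong continuity of C_0-semigroups *)

Section Semigroup.
Context {R : realType} {X : completeNormedModType R}.

Lemma op_norm_le (L : {linear X -> X}) (C : R) (x : X) :
  (op_norm L <= C%:E)%E -> `|L x| <= C * `|x|.
Proof.
move=> LC; have [->|x0] := eqVneq x 0; first by rewrite linear0 !normr0 mulr0.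
have nx : 0 < `|x| by rewrite normr_gt0.
have : (`|L (`|x|^-1 *: x)|%:E <= C%:E)%E.
  apply: le_trans LC; apply: ereal_sup_ubound; exists (`|x|^-1 *: x) => //=.
  by rewrite normrZ normfV normr_id mulVf// gt_eqF.
by rewrite lee_fin linearZ_LR normrZ normfV normr_id mulrC ler_pdivrMr.
Qed.

Lemma dist_max0 (s t : R) : `|Num.max s 0 - Num.max t 0| <= `|s - t|.
Proof.
have := ler_norm (s - t); have := ler_norm (t - s); rewrite [X in _ <= X]distrC.
rewrite ler_norml; move: `|s - t| => y; rewrite /Num.max.
by case: (ltP s 0) => ?; case: (ltP t 0) => ?; lra.
Qed.

Context (S : R -> {linear X -> X}) (M w : R).
Hypotheses (semiS : C0_semigroup S) (M0 : 0 < M) (w0 : 0 < w).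
Hypothesis boundS : forall t x, 0 <= t -> `|S t x| <= M * expR (w * t) * `|x|.

Lemma boundS_max0 t c x : t <= c -> 0 <= c ->
  `|S (Num.max t 0) x| <= M * expR (w * c) * `|x|.
Proof.
move=> tc c0; apply: (le_trans (boundS _ _)); first by rewrite le_max lexx orbT.
by rewrite ler_wpM2r// (ler_pM2l M0) ler_expR (ler_pM2l w0) ge_max tc.
Qed.

(** For [a <= b], [S b x - S a x = S a (S (b - a) x - x)], so continuity at 0+ and the local bound
    on [S a] give continuity from both sides. [Num.max t 0] extends the orbit to negative times by
    its value at 0. *)
Lemma semigroup_continuous x : continuous (fun t : R => S (Num.max t 0) x).
Proof.
have [cS S0 SD Sx] := semiS.
move=> t; apply/cvgrPdist_le => e e0.
pose K := M * expR (w * (`|t| + 1)).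
have K0 : 0 < K by rewrite mulr_gt0// expR_gt0.
have /cvgrPdist_le/(_ _ (divr_gt0 e0 K0))/near_at_right0[d d0 Hd] := Sx x.
have {}Hd k : 0 <= k < d -> `|S k x - x| <= e / K.
  rewrite le_eqVlt => /andP[/predU1P[<- _|k0 kd]].
    by rewrite S0 subrr normr0 ltW// divr_gt0.
  by rewrite distrC Hd// k0.
have key a b : 0 <= a -> a <= b -> a <= `|t| + 1 -> b - a < d ->
    `|S b x - S a x| <= e.
  move=> a0 ab at1 bad.
  have -> : S b x = S a (S (b - a) x) by rewrite -SD ?subr_ge0// addrC subrK.
  rewrite -(raddfB (S a)) (le_trans (boundS _ _))//.
  apply: (@le_trans _ _ (K * (e / K))); last by rewrite mulrC divfK// gt_eqF.
  apply: ler_pM => //; first by rewrite mulr_ge0 ?expR_ge0// ltW.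
    by rewrite /K (ler_pM2l M0) ler_expR (ler_pM2l w0).
  by apply: Hd; rewrite subr_ge0 ab.
exists (Num.min 1 d) => /=; first by rewrite lt_min ltr01.
move=> s /=; rewrite lt_min => /andP[ts1 tsd].
have := dist_max0 s t; rewrite distrC => dst.
set t' := Num.max t 0 in dst *; set s' := Num.max s 0 in dst *.
have t'0 : 0 <= t' by rewrite le_max lexx orbT.
have s'0 : 0 <= s' by rewrite le_max lexx orbT.
have tt : t' <= `|t| by rewrite ge_max ler_norm normr_ge0.
have [st|ts] := leP t' s'.
  rewrite distrC; apply: key => //; first by rewrite ler_wpDr.
  by rewrite (le_lt_trans (ler_norm _))// distrC (le_lt_trans dst)// distrC.
apply: key => //; first exact: ltW.
  by rewrite (le_trans (ltW ts))// ler_wpDr.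
by rewrite (le_lt_trans (ler_norm _))// (le_lt_trans dst)// distrC.
Qed.

(** Strong continuity is used at the fixed vector [h s] only; the variation of [h] is absorbed by
    the local bound on the operators. *)
Lemma semigroup_comp_continuous (c : R -> R) (h : R -> X) :
  continuous c -> continuous h ->
  continuous (fun s => S (Num.max (c s) 0) (h s)).
Proof.
move=> cc ch s; apply/cvgrPdist_le => e e0.
pose K := M * expR (w * (`|c s| + 1)).
have K0 : 0 < K by rewrite mulr_gt0// expR_gt0.
have e20 : 0 < e / 2 by rewrite divr_gt0.
have near1 : \forall r \near s, c r <= `|c s| + 1.
  near=> r; have : `|c s - c r| <= 1.
    by near: r; move/cvgrPdist_le : (cc s); exact.
  by rewrite ler_norml; have := ler_norm (c s); lra.
have near2 : \forall r \near s, `|h s - h r| <= e / 2 / K.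
  by move/cvgrPdist_le : (ch s); apply; rewrite divr_gt0.
have near3 : \forall r \near s,
    `|S (Num.max (c s) 0) (h s) - S (Num.max (c r) 0) (h s)| <= e / 2.
  have /cvgrPdist_le := continuous_comp (cc s) (@semigroup_continuous (h s) (c s)).
  exact.
near=> r.
rewrite (_ : _ - _ = (S (Num.max (c s) 0) (h s) - S (Num.max (c r) 0) (h s)) +
  S (Num.max (c r) 0) (h s - h r)); last by rewrite raddfB addrA subrK.
rewrite (le_trans (ler_normD _ _))// [e]splitr lerD//; first by near: r.
apply: (le_trans (@boundS_max0 _ (`|c s| + 1) _ _ _)) => //; first by near: r.
apply: (@le_trans _ _ (K * (e / 2 / K))); last by rewrite mulrC divfK// gt_eqF.
by rewrite (ler_pM2l K0); near: r.
Unshelve. all: by end_near.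
Qed.

End Semigroup.

(** * Mild solutions *)

Section Duhamel.
Context {R : realType} {X : completeNormedModType R}.
Context (S : R -> {linear X -> X}) (M w : R).
Hypotheses (semiS : C0_semigroup S) (M0 : 0 < M) (w0 : 0 < w).
Hypothesis boundS : forall t x, 0 <= t -> `|S t x| <= M * expR (w * t) * `|x|.

(** The truncation makes the integrand continuous on the whole line for continuous [h], so that
    [primitive] is meaningful; over [[0, t]] it changes nothing. *)
Definition duhamel_integrand (h : R -> X) (t s : R) : X :=
  S (Num.max s 0) (h (t - s)).

(* int_0^t S(s) h(t - s) ds *)
Definition duhamel (h : R -> X) (t : R) : X :=
  primitive (duhamel_integrand h t) t.

Lemma continuous_duhamel_integrand (h : R -> X) (t : R) : continuous h ->
  continuous (duhamel_integrand h t).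
Proof.
move=> ch; apply: (semigroup_comp_continuous semiS M0 w0 boundS).
  by move=> s; exact: cvg_id.
move=> s; apply: (@continuous_comp _ _ _ (fun s => t - s) h); last exact: ch.
by apply: cvgB; [exact: cvg_cst|exact: cvg_id].
Qed.

Lemma duhamel_integrandE (h : R -> X) (t s : R) : 0 <= s ->
  duhamel_integrand h t s = S s (h (t - s)).
Proof. by move=> s0; rewrite /duhamel_integrand (max_idPl s0). Qed.

Lemma duhamelB (h k : R -> X) (t : R) : 0 <= t -> continuous h -> continuous k ->
  duhamel (fun s => h s - k s) t = duhamel h t - duhamel k t.
Proof.
move=> t0 ch ck; rewrite /duhamel -primitiveB//; last 2 first.
  exact: continuous_duhamel_integrand.
  exact: continuous_duhamel_integrand.
by congr (primitive _ t); apply/funext => s; rewrite /duhamel_integrand raddfB.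
Qed.

(** Compare with int_0^t M e^(w s) C e^(l (t - s)) ds, whose antiderivative is [phi]. The factor 1 /
    (l - w), small for large [l], is the source of the contraction. *)
Lemma duhamel_le (h : R -> X) (t l C : R) : 0 <= t -> w < l -> continuous h -> 0 <= C ->
  (forall s, 0 <= s <= t -> `|h s| <= C * expR (l * s)) ->
  `|duhamel h t| <= M * C / (l - w) * expR (l * t).
Proof.
move=> t0 wl ch C0 hC.
have lw : 0 < l - w by rewrite subr_gt0.
pose K := M * C * expR (l * t).
have K0 : 0 <= K by rewrite !mulr_ge0 ?expR_ge0// ltW.
pose phi (s : R) : R^o := - (K / (l - w)) * expR ((w - l) * s).
pose psi (s : R) : R^o := K * expR ((w - l) * s).
have dphi (s : R) : is_derive s 1 phi (psi s).
  rewrite /phi /psi; apply: is_derive_eq.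
  by rewrite /GRing.scale/= mulr1; field; rewrite gt_eqF.
have cphi : continuous phi.
  move=> s; apply: differentiable_continuous; apply/derivable1_diffP.
  exact: (@ex_derive _ _ _ _ _ _ _ (dphi s)).
have := @primitive_le R X (duhamel_integrand h t) phi psi 0 t t0
  (@continuous_duhamel_integrand h t ch) cphi.
rewrite primitive0 ?subr0; last exact: continuous_duhamel_integrand.
move=> /(_ _ _)/le_trans; apply.
- by move=> s _; exact: right_derivative_is_derive.
- move=> s /andP[s0 st]; rewrite (duhamel_integrandE _ _ (ltW s0)).
  rewrite (le_trans (boundS _ (ltW s0)))//.
  have := hC (t - s); rewrite subr_ge0 (ltW st) gerBl (ltW s0) => /(_ isT) hts.
  have -> : psi s = M * expR (w * s) * (C * expR (l * (t - s))).
    rewrite /psi /K -!mulrA; congr (_ * _).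
    rewrite [expR (w * s) * _]mulrCA; congr (_ * _).
    by rewrite -!expRD; congr expR; ring.
  by rewrite ler_wpM2l// mulr_ge0 ?expR_ge0// ltW.
- rewrite /phi mulr0 expR0 mulr1 opprK mulNr.
  rewrite addrC (_ : _ * C / _ * _ = K / (l - w)); last first.
    by rewrite /K; field; rewrite gt_eqF.
  by rewrite gerBl mulr_ge0 ?expR_ge0// divr_ge0// ltW.
Qed.

(** Split the integral at [k]; on the second piece put [s = k + s'], so that
    [S (k + s') = S k (S s')] and the argument of [h] becomes [t - s']. *)
Lemma duhamelD (h : R -> X) (t k : R) : 0 <= t -> 0 <= k -> continuous h ->
  duhamel h (t + k) =
  S k (duhamel h t) + primitive (duhamel_integrand h (t + k)) k.
Proof.
move=> t0 k0 ch; have [cS S0 SD _] := semiS.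
have ci s := @continuous_duhamel_integrand h s ch.
pose G r := primitive (duhamel_integrand h (t + k)) (k + r).
have -> : duhamel h (t + k) = G t by rewrite /duhamel /G [k + t]addrC.
rewrite (@primitive_unique _ _ G (fun s => S k (duhamel_integrand h t s)))//.
- by rewrite /G addr0 addrC (primitive_linear t0 (cS k k0) (ci t)).
- move=> s; apply: (@continuous_comp _ _ _ (fun s => k + s)).
    by apply: cvgD; [exact: cvg_cst|exact: cvg_id].
  exact: continuous_primitive.
- by move=> s; apply: continuous_cvg; [exact: cS|exact: ci].
- move=> s /andP[/ltW s0 _]; rewrite duhamel_integrandE// -SD//.
  have -> : S (k + s) (h (t - s)) = duhamel_integrand h (t + k) (k + s).
    by rewrite duhamel_integrandE ?addr_ge0//; congr (S _ (h _)); ring.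
  by apply: right_derivative_shift; exact: right_derivative_primitive.
Qed.

Lemma continuous_duhamel (h : R -> X) : continuous h ->
  continuous (fun t : R => duhamel h (Num.max t 0)).
Proof.
move=> ch r; apply/cvgrPdist_le => e e0.
set t0 := Num.max r 0; have t00 : 0 <= t0 by rewrite le_max lexx orbT.
have ci s := @continuous_duhamel_integrand h s ch.
pose K := M * expR (w * (t0 + 1)).
have K0 : 0 < K by rewrite mulr_gt0// expR_gt0.
have [C C0 hC] := bounded_on_segment (- (t0 + 1)) (t0 + 1) ch.
(* The shifts by 1 here and in [K * C + 1] keep the denominators positive, as [t0] and [C] may be
   0. *)
have eK : 0 < e / 2 / (K * (t0 + 1)) by rewrite !divr_gt0// mulr_gt0//; lra.
have [d d0 Hd] := uniform_continuity 0 (t0 + 1) ch eK.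
have KC : 0 < K * C + 1 by rewrite ltr_wpDl// mulr_ge0// ltW.
have boundK s x : s <= t0 + 1 -> `|S (Num.max s 0) x| <= K * `|x|.
  by move=> st; apply: boundS_max0 => //; lra.
have lip a b c : 0 <= a -> a <= b -> b <= t0 + 1 -> 0 <= c <= t0 + 1 ->
    `|primitive (duhamel_integrand h c) b - primitive (duhamel_integrand h c) a|
    <= (K * C + 1) * (b - a).
  move=> a0 ab bt ct; apply: primitive_lipschitz => // s sab.
  rewrite (le_trans (boundK _ _ _))//; first by lra.
  apply: (@le_trans _ _ (K * C)); last by lra.
  by rewrite (ler_pM2l K0) hC//; lra.
exists (Num.min 1 (Num.min d (e / 2 / (K * C + 1)))) => /=.
  by rewrite !lt_min ltr01 d0 !divr_gt0.
move=> s /=; rewrite !lt_min => /and3P[rs1 rsd rse].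
have := dist_max0 s r; rewrite distrC -/t0; set t := Num.max s 0 => dst.
have tt : 0 <= t by rewrite le_max lexx orbT.
rewrite distrC in dst.
have {rs1} tt1 : `|t - t0| < 1 by rewrite (le_lt_trans dst)// distrC.
have {}rsd : `|t - t0| < d by rewrite (le_lt_trans dst)// distrC.
have {dst} {}rse : `|t - t0| < e / 2 / (K * C + 1).
  by rewrite (le_lt_trans dst)// distrC.
have tle : t <= t0 + 1 by move: tt1; rewrite ltr_norml; lra.
rewrite /duhamel distrC (_ : _ - _ =
  (primitive (duhamel_integrand h t) t - primitive (duhamel_integrand h t) t0) +
  (primitive (duhamel_integrand h t) t0 -
   primitive (duhamel_integrand h t0) t0)); last first.
  by rewrite addrA subrK.
rewrite (le_trans (ler_normD _ _))// [e]splitr lerD//.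
  rewrite ltr_pdivlMr// mulrC in rse; apply: le_trans (ltW rse).
  have [le|/ltW le] := leP t0 t.
    by rewrite (ger0_norm (_ : 0 <= t - t0)) ?subr_ge0// lip//; lra.
  rewrite distrC [X in _ * X]distrC (ger0_norm (_ : 0 <= t0 - t)) ?subr_ge0//.
  by rewrite lip//; lra.
rewrite -primitiveB//.
have := @primitive_lipschitz _ _
  (fun s => duhamel_integrand h t s - duhamel_integrand h t0 s)
  0 t0 (K * (e / 2 / (K * (t0 + 1)))) t00.
rewrite primitive0; last by move=> u; apply: cvgB; exact: ci.
rewrite !subr0 => H; apply: (le_trans (H _ _)).
- by move=> u; apply: cvgB; exact: ci.
- move=> u /andP[u0 ut]; rewrite /duhamel_integrand -raddfB.
  rewrite (le_trans (boundK _ _ _))//; first by lra.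
  rewrite (ler_pM2l K0) distrC Hd//; first by lra.
  by rewrite (_ : _ - _ = t0 - t) 1?distrC//; ring.
- have t01 : 0 < t0 + 1 by lra.
  rewrite (_ : K * _ * t0 = e / 2 * (t0 / (t0 + 1))); last first.
    by field; rewrite !gt_eqF.
  by rewrite ger_pMr ?divr_gt0// ler_pdivrMr// mul1r lerDl.
Qed.

Lemma duhamel0 (h : R -> X) : continuous h -> duhamel h 0 = 0.
Proof.
by move=> ch; rewrite /duhamel primitive0//; exact: continuous_duhamel_integrand.
Qed.

(** Uniformity in [r] comes from compactness of [[0, t]]. It yields (1/k) int_0^k S(s) h(r + k - s)
    ds -> h(r) uniformly in r, so that the limit survives integration over r. *)
Lemma duhamel_integrand_near (h : R -> X) (t e : R) : continuous h -> 0 < e ->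
  exists2 d, 0 < d & forall r k s, 0 <= r <= t -> 0 <= s -> s <= k -> k < d ->
    `|duhamel_integrand h (r + k) s - h r| <= e.
Proof.
move=> ch e0; have [cS S0 SD Sx] := semiS.
have /compact_near_coveringP cab := @segment_compact R 0 t.
have [] := @cab R (0^'+) (fun k r => forall s, 0 <= s -> s <= k ->
    `|duhamel_integrand h (r + k) s - h r| <= e); last first.
  move=> d /= d0 Hd; exists (d / 2); first by rewrite divr_gt0.
  move=> r k s rt s0 sk kd.
  have [k0|] := ltP 0 k; last first.
    move=> k0; have -> : k = 0 by lra.
    have -> : s = 0 by lra.
    by rewrite duhamel_integrandE// S0 subr0 addr0 subrr normr0 ltW.
  by apply: (Hd k) => //=; rewrite sub0r normrN gtr0_norm//; lra.
move=> r0 _.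
pose K := M * expR (w * 1); have K0 : 0 < K by rewrite mulr_gt0// expR_gt0.
have e3 : 0 < e / 3 by rewrite divr_gt0.
have /cvgrPdist_le/(_ _ (divr_gt0 e3 K0)) [d1 /= d10 Hd1] := ch r0.
have /cvgrPdist_le/(_ _ e3) [d2 /= d20 Hd2] := ch r0.
have /cvgrPdist_le/(_ _ e3)/near_at_right0[d3 d30 Hd3] := Sx (h r0).
have {}Hd3 s : 0 <= s < d3 -> `|S s (h r0) - h r0| <= e / 3.
  rewrite le_eqVlt => /andP[/predU1P[<- _|s0 sd]].
    by rewrite S0 subrr normr0 ltW.
  by rewrite distrC Hd3// s0.
pose d := Num.min (Num.min 1 d1) (Num.min d2 d3).
have d0 : 0 < d by rewrite !lt_min ltr01 d10 d20.
exists (ball r0 (d / 2), [set k | k < d / 2]) => /=.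
  split; first by apply: nbhsx_ballx; rewrite divr_gt0.
  by apply/near_at_right0; exists (d / 2); [rewrite divr_gt0|move=> k /andP[]].
move=> [r k] [/= rr kd] s s0 sk.
have [[d11 d12] [d22 d23]] : (d <= 1 /\ d <= d1) /\ (d <= d2 /\ d <= d3).
  by do 2?split; rewrite /d !ge_min lexx ?orbT.
have {rr} rr : `|r0 - r| < d / 2 by [].
rewrite duhamel_integrandE//.
rewrite (_ : _ - _ = S s (h (r + k - s) - h r0) +
  ((S s (h r0) - h r0) + (h r0 - h r))); last first.
  by rewrite raddfB !addrA !subrK.
rewrite (le_trans (ler_normD _ _))// (_ : e = e / 3 + (e / 3 + e / 3)); last by field.
apply: lerD; last first.
  rewrite (le_trans (ler_normD _ _))// lerD//; first by apply: Hd3; lra.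
  by apply: Hd2 => /=; lra.
apply: (le_trans (boundS _ s0)).
apply: (@le_trans _ _ (K * (e / 3 / K))); last by rewrite mulrC divfK// gt_eqF.
apply: ler_pM => //; first by rewrite mulr_ge0 ?expR_ge0// ltW.
  by rewrite /K (ler_pM2l M0) ler_expR (ler_pM2l w0); lra.
rewrite distrC; apply: Hd1 => /=.
rewrite (_ : r0 - _ = (r0 - r) - (k - s)); last by ring.
rewrite (le_lt_trans (ler_normB _ _))// (ger0_norm (_ : 0 <= k - s)) ?subr_ge0//; lra.
Qed.

Lemma generator_right_derivative (D : set X) (A : X -> X) x y :
  is_generator D A S -> (D x /\ A x = y) <-> right_derivative (S ^~ x) 0 y.
Proof.
move=> /(_ x y) ->; have [_ S0 _ _] := semiS.
rewrite /right_derivative (_ : diffquo (S ^~ x) 0 = fun h => h^-1 *: (S h x - x))//.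
by apply/funext => k; rewrite /diffquo add0r S0.
Qed.

(* The increments [u (t + k) - u t] are computed by integrating the semigroup
   property of the mild solution [v = u'], which avoids Fubini and the
   differentiation of a convolution. *)
Lemma mild_solution_generator (D : set X) (A : X -> X) (x0 g0 : X)
    (v h : R -> X) (t : R) :
  is_generator D A S -> D x0 -> continuous v -> continuous h ->
  (forall s, 0 <= s -> v s = S s (A x0 + g0) + duhamel h s) -> 0 <= t ->
  D (x0 + primitive v t) /\
  A (x0 + primitive v t) = v t - (g0 + primitive h t).
Proof.
move=> genA Dx0 cv ch vE t0; have [cS S0 SD Sx] := semiS.
pose u s := x0 + primitive v s.
have v0 : v 0 = A x0 + g0 by rewrite vE// S0 duhamel0// addr0.
have ci s := @continuous_duhamel_integrand h s ch.
have du s : right_derivative u s (v s).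
  rewrite -[v s]add0r; apply: right_derivativeD; first exact: right_derivative_cst.
  exact: right_derivative_primitive.
have cu : continuous u.
  by move=> s; apply: cvgD; [exact: cvg_cst|exact: continuous_primitive].
(* [Phi k r] measures how far [u - x0] is from obeying [S], and vanishes at [r = 0]. By [duhamelD]
   its derivative in [r] is the Duhamel integral over [[0, k]], about [k *: h r] for small [k];
   hence [Phi k t] is about [k *: primitive h t]. *)
pose Phi k r := u (r + k) - u k - S k (u r - x0).
have u0 : u 0 = x0 by rewrite /u primitive0// addr0.
pose E k r := primitive (duhamel_integrand h (r + k)) k.
have dPhi k r : 0 <= k -> 0 <= r -> right_derivative (Phi k) r (E k r).
  move=> k0 r0.
  have -> : E k r = v (r + k) - 0 - S k (v r - 0).
    rewrite !subr0 !vE ?addr_ge0// duhamelD// (linearD (S k)) -SD// [k + r]addrC.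
    by rewrite opprD addrACA subrr add0r addrAC subrr add0r.
  apply: right_derivativeB; first apply: right_derivativeB.
  - rewrite (_ : (fun s => _) = (fun s => u (k + s))).
      by apply: right_derivative_shift; rewrite addrC.
    by apply/funext => s; rewrite addrC.
  - exact: right_derivative_cst.
  - apply: right_derivative_linear; first exact: cS.
    by apply: right_derivativeB => //; exact: right_derivative_cst.
have cPhi k : 0 <= k -> continuous (Phi k).
  move=> k0 r; apply: cvgB; first apply: cvgB; last 2 first.
  - exact: cvg_cst.
  - apply: continuous_cvg; first exact: cS.
    by apply: cvgB; [exact: cu|exact: cvg_cst].
  apply: (@continuous_comp _ _ _ (fun r => r + k)); last exact: cu.
  by apply: cvgD; [exact: cvg_id|exact: cvg_cst].
have dPhi0 : right_derivative (Phi ^~ t) 0 (primitive h t).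
  apply/right_derivativeP => e e0.
  have t1 : 0 < t + 1 by lra.
  have [d d0 Hd] := duhamel_integrand_near t ch (divr_gt0 e0 t1).
  apply/near_at_right0; exists d => // k /andP[k0 kd].
  have k0' := ltW k0.
  rewrite /= add0r (_ : Phi 0 t = 0); last first.
    by rewrite /Phi u0 addr0 S0 subrr.
  rewrite subr0 (_ : _ - _ = (Phi k t - k *: primitive h t) -
    (Phi k 0 - k *: primitive h 0)); last first.
    by rewrite primitive0// scaler0 /Phi add0r u0 !subrr linear0 !subr0.
  apply: (@le_trans _ _ (e / (t + 1) * k * (t - 0))); last first.
    rewrite subr0 mulrAC ler_pM2r// -mulrA ger_pMr// mulrC ler_pdivrMr//.
    by rewrite mul1r lerDl.
  apply: (@mean_value_ineq_cst _ _ (fun r => Phi k r - k *: primitive h r)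
    (fun r => E k r - k *: h r)) => //.
  - move=> r; apply: cvgB; first exact: cPhi.
    by apply: cvgZl_tmp; exact: continuous_primitive.
  - move=> r /andP[r0 _]; apply: right_derivativeB; first by apply: dPhi => //; exact: ltW.
    apply: (right_derivative_linear (L := *:%R k)).
      by move=> z; apply: cvgZl_tmp; exact: cvg_id.
    exact: right_derivative_primitive.
  move=> r /andP[r0 rt].
  have -> : E k r - k *: h r = (primitive (duhamel_integrand h (r + k)) k - k *: h r)
      - (primitive (duhamel_integrand h (r + k)) 0 - 0 *: h r).
    by rewrite primitive0// scale0r !subr0.
  rewrite -[X in _ <= _ * X]subr0.
  apply: (@mean_value_ineq_cst _ _
    (fun s => primitive (duhamel_integrand h (r + k)) s - s *: h r)
    (fun s => duhamel_integrand h (r + k) s - h r)) => //.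
  - move=> s; apply: cvgB; first exact: continuous_primitive.
    by apply: cvgZr_tmp; exact: cvg_id.
  - move=> s _; apply: right_derivativeB; first exact: right_derivative_primitive.
    exact: right_derivative_scale.
  - move=> s /andP[s0 sk]; apply: Hd => //; rewrite ?(ltW s0) ?(ltW sk)//.
    by rewrite (ltW r0) (ltW rt).
apply/(generator_right_derivative _ _ genA).
rewrite -/(u t).
have Ax0 : right_derivative (S ^~ x0) 0 (A x0).
  exact/(generator_right_derivative _ _ genA).
(* The definition of [Phi k t] solved for [S k (u t)]: every term is now known to be right
   differentiable at [k = 0], which puts [u t] into the domain. *)
have -> : S ^~ (u t) = fun k => u (t + k) - u k - Phi k t + S k x0.
  by apply/funext => k; rewrite /Phi subKr linearB subrK.
have -> : v t - (g0 + primitive h t) = v t - v 0 - primitive h t + A x0.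
  rewrite v0 [in RHS]opprD [- A x0 - g0]addrC !addrA opprD addrA.
  by rewrite [RHS]addrAC subrK.
apply: right_derivativeD => //; apply: right_derivativeB => //.
apply: right_derivativeB => //.
by apply: right_derivative_shift; rewrite addr0.
Qed.

End Duhamel.

(** Factoring [S (t - s)] as [S (t - s - k)] after [S k] turns the increment into S(t - s - k)
    applied to (W(s + k) - W(s)) - (S(k) W(s) - W(s)). The generator is thus met at the single
    vector [W s]. *)
Lemma semigroup_product_right_derivative (R : realType)
    (X : completeNormedModType R) (S : R -> {linear X -> X}) (M w : R)
    (W : R -> X) (s t : R) (z z' : X) : C0_semigroup S -> 0 < M -> 0 < w ->
  (forall r x, 0 <= r -> `|S r x| <= M * expR (w * r) * `|x|) ->
  s < t -> right_derivative W s z -> right_derivative (S ^~ (W s)) 0 z' ->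
  right_derivative (fun r => S (Num.max (t - r) 0) (W r)) s (S (t - s) (z - z')).
Proof.
move=> semiS M0 w0 boundS st dW dS; have [_ S0 SD _] := semiS.
apply/right_derivativeP => e e0.
have ts0 : 0 <= t - s by rewrite subr_ge0 ltW.
pose K := M * expR (w * (t - s)).
have K0 : 0 < K by rewrite mulr_gt0 ?expR_gt0.
have e3 : 0 < e / 3 by rewrite divr_gt0.
have eK : 0 < e / 3 / K by rewrite divr_gt0.
have /right_derivativeP/(_ _ eK)/near_at_right0[d1 d10 H1] := dW.
have /right_derivativeP/(_ _ eK)/near_at_right0[d2 d20 H2] := dS.
have /cvgrPdist_le/(_ _ e3)[d3 /= d30 H3] :=
  @semigroup_continuous R X S M w semiS M0 w0 boundS (z - z') (t - s).
apply/near_at_right0; exists (Num.min (Num.min d1 d2) (Num.min d3 (t - s))).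
  by rewrite !lt_min d10 d20 d30 subr_gt0.
move=> k; rewrite !lt_min => /andP[k0 /andP[/andP[kd1 kd2] /andP[kd3 kts]]].
have tsk : 0 <= t - s - k by lra.
have {}H1 : `|W (s + k) - W s - k *: z| <= e / 3 / K * k by apply: H1; rewrite k0.
have {}H2 : `|S k (W s) - W s - k *: z'| <= e / 3 / K * k.
  by have := H2 k; rewrite add0r S0; apply; rewrite k0.
have {}H3 : `|S (t - s - k) (z - z') - S (t - s) (z - z')| <= e / 3.
  have := H3 (t - s - k); rewrite (max_idPl ts0) (max_idPl tsk) distrC; apply.
  by rewrite /= (_ : t - s - (t - s - k) = k) ?gtr0_norm//; ring.
have boundK x : `|S (t - s - k) x| <= K * `|x|.
  apply: (le_trans (boundS _ _ tsk)); rewrite ler_wpM2r// ler_wpM2l ?(ltW M0)//.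
  by rewrite ler_expR ler_wpM2l ?(ltW w0)//; lra.
rewrite (max_idPl ts0) opprD addrA (max_idPl tsk).
have -> : S (t - s) (W s) = S (t - s - k) (S k (W s)).
  by rewrite -SD ?(ltW k0)// subrK.
rewrite -linearB (_ : _ - _ = S (t - s - k) (W (s + k) - W s - k *: z) -
  S (t - s - k) (S k (W s) - W s - k *: z') +
  k *: (S (t - s - k) (z - z') - S (t - s) (z - z'))); last first.
  rewrite [k *: (_ - S (t - s) _)]scalerBr addrA; congr (_ - _).
  rewrite -linearZ_LR -linearB -linearD; congr (S _ _).
  rewrite scalerBr; move: (k *: z) (k *: z') => a a'.
  rewrite [- (_ - _ - a')]opprB -[RHS]addrA [_ + (a - a')]addrC [a - a' + _]addrA.
  by rewrite subrK [RHS]addrA subrK opprB addrA subrK.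
rewrite (le_trans (ler_normD _ _))// normrZ (gtr0_norm k0).
rewrite (_ : e * k = (e / 3 * k + e / 3 * k) + k * (e / 3)); last by field.
apply: lerD; last by rewrite (ler_pM2l k0).
have KE : e / 3 * k = K * (e / 3 / K * k) by field; rewrite gt_eqF.
rewrite (le_trans (ler_normB _ _))// KE lerD//.
  by rewrite (le_trans (boundK _))// (ler_pM2l K0).
by rewrite (le_trans (boundK _))// (ler_pM2l K0).
Qed.

(** * Weighted convolutions of multi-indexed families *)

Section Weights.
Context {R : realType}.
Implicit Types (alpha beta : mindex).

Lemma weight_gt0 (c : R) alpha : 0 < weight c alpha.
Proof. by rewrite /weight prodr_gt0// => n _; rewrite powR_gt0// ltr0n. Qed.

Lemma weight_ge0 (c : R) alpha : 0 <= weight c alpha.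
Proof. exact/ltW/weight_gt0. Qed.

Lemma weight_subset (c : R) alpha (F : {fset nat}) : {subset finsupp alpha <= F} ->
  weight c alpha = \prod_(n <- F) (2 * n.+1)%:R `^ (c * (alpha n)%:R).
Proof.
move=> sF; rewrite /weight; apply: big_fset_incl; first exact/fsubsetP.
by move=> n _ /fsfun_dflt ->; rewrite mulr0 powRr0.
Qed.

Lemma weight_mul (c : R) alpha beta : mindex_le beta alpha ->
  weight c alpha = weight c beta * weight c (mindex_sub alpha beta).
Proof.
move=> ba; rewrite (@weight_subset c beta (finsupp alpha)); last first.
  move=> n; rewrite !mem_finsupp; apply: contra => /eqP an.
  by have := ba n; rewrite an leqn0.
rewrite (@weight_subset c (mindex_sub alpha beta) (finsupp alpha)); last first.
  by move=> n; rewrite !mem_finsupp mindex_subE; apply: contra => /eqP ->; rewrite sub0n.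
rewrite -big_split/=; apply: eq_bigr => n _.
rewrite -powRD; last by rewrite pnatr_eq0 implybT.
by rewrite mindex_subE -mulrDr -natrD subnKC.
Qed.

Lemma weight_half (c : R) alpha : weight (c / 2) alpha ^+ 2 = weight c alpha.
Proof.
rewrite /weight -prodrXl; apply: eq_bigr => n _.
rewrite expr2 -powRD; last by rewrite pnatr_eq0 implybT.
by congr (_ `^ _); field.
Qed.

Lemma weight_le (c d : R) alpha : c <= d -> weight c alpha <= weight d alpha.
Proof.
move=> cd; apply: ler_prod => n _; rewrite powR_ge0 ler_powR//.
  by rewrite ler1n muln_gt0.
by rewrite ler_wpM2r.
Qed.

Definition below alpha : {fset mindex} :=
  fset_set [set beta | mindex_le beta alpha].

Lemma in_below beta alpha : (beta \in below alpha) = (`[< mindex_le beta alpha >]).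
Proof.
rewrite in_fset_set; last exact: finite_mindex_le.
by apply/idP/asboolP; rewrite inE.
Qed.

Lemma mindex_sub_inj beta : {in [pred alpha | beta \in below alpha] &,
  injective (mindex_sub ^~ beta)}.
Proof.
move=> a a'; rewrite !inE !in_below => /asboolP ba /asboolP ba' e.
apply/fsfunP => n; have := congr1 (fun g : mindex => g n) e; rewrite !mindex_subE.
by move=> e'; rewrite -(subnKC (ba n)) e' subnKC.
Qed.

Definition convolution (b x : mindex -> R) alpha : R :=
  \sum_(beta <- below alpha) b beta * x (mindex_sub alpha beta).

Lemma conv_ge0 (b x : mindex -> R) alpha : (forall i, 0 <= b i) ->
  (forall i, 0 <= x i) -> 0 <= convolution b x alpha.
Proof. by move=> b0 x0; rewrite sumr_ge0// => i _; rewrite mulr_ge0. Qed.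

Lemma le_conv (b b' x y : mindex -> R) alpha : (forall i, 0 <= b i <= b' i) ->
  (forall i, 0 <= x i <= y i) -> convolution b x alpha <= convolution b' y alpha.
Proof.
move=> bb' xy; apply: ler_sum => i _.
have /andP[? ?] := bb' i; have /andP[? ?] := xy (mindex_sub alpha i).
exact: ler_pM.
Qed.

Lemma convZ (b x : mindex -> R) (c : R) alpha :
  convolution b (fun i => c * x i) alpha = c * convolution b x alpha.
Proof. by rewrite /convolution mulr_sumr; apply: eq_bigr => i _; rewrite mulrCA. Qed.

(** The weight of [alpha] factors along each [beta <= alpha]; weighted estimates of convolutions
    thus reduce to unweighted ones. *)
Lemma conv_weight (b x : mindex -> R) (c : R) alpha :
  convolution (fun i => b i * weight c i) (fun i => x i * weight c i) alpha =
  convolution b x alpha * weight c alpha.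
Proof.
rewrite /convolution mulr_suml; apply: eq_big_seq => i.
by rewrite in_below => /asboolP ia; rewrite (weight_mul c ia); ring.
Qed.

(** For non-negative [x], a bound on the whole series, stated through its finite partial sums. *)
Definition sums_le (x : mindex -> R) (C : R) : Prop :=
  forall s : seq mindex, uniq s -> \sum_(i <- s) x i <= C.

Lemma sums_le_term (x : mindex -> R) (C : R) i : sums_le x C -> x i <= C.
Proof. by move=> /(_ [:: i] isT); rewrite big_seq1. Qed.

(** Young's inequality in l^1: after exchanging the sums, [alpha - beta] with [beta] fixed runs
    through distinct indices ([mindex_sub_inj]), so each inner sum is at most [C]. *)
Lemma sums_le_conv (b x : mindex -> R) (K C : R) : 0 <= C ->
  (forall i, 0 <= b i) -> (forall i, 0 <= x i) ->
  sums_le b K -> sums_le x C -> sums_le (convolution b x) (K * C).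
Proof.
move=> C0 b0 x0 bK xC s us; rewrite /convolution.
pose t := undup (flatten [seq enum_fset (below i) | i <- s]).
have -> : \sum_(i <- s) \sum_(j <- below i) b j * x (mindex_sub i j) =
    \sum_(i <- s) \sum_(j <- t | j \in below i) b j * x (mindex_sub i j).
  apply: eq_big_seq => i si; rewrite -[RHS]big_filter; apply: perm_big.
  apply: uniq_perm; first exact: fset_uniq.
    by rewrite filter_uniq// undup_uniq.
  move=> j; rewrite mem_filter mem_undup; case: (boolP (j \in below i)) => //= ji.
  by apply/esym/flatten_mapP; exists i.
under eq_bigr do rewrite big_mkcond.
rewrite exchange_big/=.
apply: (@le_trans _ _ (\sum_(j <- t) b j * C)); last first.
  by rewrite -mulr_suml ler_wpM2r// bK// undup_uniq.
apply: ler_sum => j _; rewrite -big_mkcond -mulr_sumr ler_wpM2l//.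
rewrite -big_filter -(big_map (mindex_sub ^~ j) xpredT x); apply: xC.
rewrite map_inj_in_uniq ?filter_uniq// => a a'.
rewrite !mem_filter => /andP[ja _] /andP[ja' _].
by apply: mindex_sub_inj; rewrite inE.
Qed.

(** Expand sum_i b_i (y_i - Y/K)^2 >= 0 with Y = sum_i b_i y_i, and replace the sum of the b_i by
    its bound [K] in the last term: what remains is sum_i b_i y_i^2 - Y^2/K >= 0. *)
Lemma weighted_cauchy_schwarz (I : Type) (s : seq I) (b y : I -> R) (K : R) :
  0 < K -> (forall i, 0 <= b i) -> \sum_(i <- s) b i <= K ->
  (\sum_(i <- s) b i * y i) ^+ 2 <= K * \sum_(i <- s) b i * y i ^+ 2.
Proof.
move=> K0 b0 bK; set Y := \sum_(i <- s) b i * y i.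
have : 0 <= \sum_(i <- s) b i * (y i - Y / K) ^+ 2.
  by apply: sumr_ge0 => i _; rewrite mulr_ge0// sqr_ge0.
have -> : \sum_(i <- s) b i * (y i - Y / K) ^+ 2 =
   \sum_(i <- s) b i * y i ^+ 2 - 2 * (Y / K) * Y + (Y / K) ^+ 2 * \sum_(i <- s) b i.
  rewrite /Y !mulr_sumr -sumrB -big_split/=; apply: eq_bigr => i _; ring.
move=> H.
have : (Y / K) ^+ 2 * \sum_(i <- s) b i <= (Y / K) ^+ 2 * K.
  by rewrite ler_wpM2l// sqr_ge0.
have -> : (Y / K) ^+ 2 * K = Y ^+ 2 / K by field; rewrite gt_eqF.
move: H; have -> : 2 * (Y / K) * Y = 2 * (Y ^+ 2 / K) by field; rewrite gt_eqF.
move=> H H'; rewrite mulrC -ler_pdivrMr//; lra.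
Qed.

Lemma cvg_sumr (V : normedModType R) (T I : Type) (F : set_system T) (r : seq I)
    (f : I -> T -> V) (l : I -> V) : Filter F ->
  (forall i, f i x @[x --> F] --> l i) ->
  \sum_(i <- r) f i x @[x --> F] --> \sum_(i <- r) l i.
Proof. by move=> FF fl; apply: cvg_big => //; exact: add_continuous. Qed.

Lemma cvg_conv (b : mindex -> R) (x : nat -> mindex -> R) (y : mindex -> R) alpha :
  (forall i, x m i @[m --> \oo] --> y i) ->
  convolution b (x m) alpha @[m --> \oo] --> convolution b y alpha.
Proof.
move=> xy; rewrite /convolution; apply: cvg_sumr => i.
by apply: cvgMr.
Qed.

(* The Neumann series of the convolution operator, bounded in l^1. *)
Lemma l1_supersolution (b x : mindex -> R) (K C eta : R) : 0 <= C -> 0 <= eta ->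
  (forall i, 0 <= b i) -> (forall i, 0 <= x i) ->
  sums_le b K -> sums_le x C -> 2 * (eta * K) <= 1 ->
  exists2 Q : mindex -> R, sums_le Q (2 * C) &
    forall i, 0 <= Q i /\ x i + eta * convolution b Q i <= Q i.
Proof.
move=> C0 eta0 b0 x0 bK xC etaK.
pose X := fix X n i := if n is m.+1 then x i + eta * convolution b (X m) i else 0.
have X0 n i : 0 <= X n i.
  elim: n i => [//|n IH] i /=.
  by rewrite addr_ge0 ?mulr_ge0// conv_ge0.
have XS n i : X n i <= X n.+1 i.
  elim: n i => [|n IH] i; first exact: X0.
  rewrite [X n.+2 i]/= [X n.+1 i]/= lerD2l ler_wpM2l// le_conv => // j.
    by rewrite b0 lexx.
  by rewrite X0 IH.
(* The bound [2 * C] reproduces itself: one more step gives at most [C + eta * K * (2 * C)], and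
   [2 * (eta * K) <= 1]. *)
have XC n : sums_le (X n) (2 * C).
  elim: n => [|n IH] s us /=.
    by rewrite big1 ?mulr_ge0.
  rewrite big_split/= -mulr_sumr mulr_natl mulr2n lerD// ?xC//.
  have H : \sum_(i <- s) convolution b (X n) i <= K * (2 * C).
    by apply: sums_le_conv => //; rewrite mulr_ge0.
  apply: le_trans (ler_wpM2l eta0 H) _.
  have -> : eta * (K * (2 * C)) = 2 * (eta * K) * C by ring.
  by rewrite ler_piMl.
have cX i : cvgn (X ^~ i).
  apply: nondecreasing_is_cvgn.
    by apply/nondecreasing_seqP => n; exact: XS.
  by exists (2 * C) => _ [n _ <-]; exact: sums_le_term (XC n).
pose Q i := lim (X n i @[n --> \oo]).
have XQ i : X n i @[n --> \oo] --> Q i by exact: cX.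
exists Q.
  move=> s us; have : \sum_(i <- s) X n i @[n --> \oo] --> \sum_(i <- s) Q i.
    by apply: cvg_sumr => i.
  by move=> /cvgr_to_le; apply; near=> n; exact: XC.
move=> i; split.
  have := @nondecreasing_cvgn_le _ (X ^~ i) _ (cX i) 0%N; apply.
  by apply/nondecreasing_seqP => m; exact: XS.
have : x i + eta * convolution b (X n) i @[n --> \oo] --> x i + eta * convolution b Q i.
  by apply: cvgD; [exact: cvg_cst|apply: cvgMr; exact: cvg_conv].
move=> /cvgr_to_le; apply; near=> n.
have := @nondecreasing_cvgn_le _ (X ^~ i) _ (cX i) n.+1; apply.
by apply/nondecreasing_seqP => m; exact: XS.
Unshelve. all: by end_near.
Qed.

Definition l2 (q : R) (a : mindex -> R) : Prop :=
  exists2 C, 0 <= C & sums_le (fun i => a i ^+ 2 * weight (- q) i) C.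

Lemma l2_exponent_le (q q' : R) (a : mindex -> R) : q <= q' -> l2 q a -> l2 q' a.
Proof.
move=> qq' [C C0 aC]; exists C => // s us; apply: le_trans (aC s us).
by apply: ler_sum => i _; rewrite ler_wpM2l ?sqr_ge0// weight_le// lerN2.
Qed.

Lemma l2Z (q c : R) (a : mindex -> R) : l2 q a -> l2 q (fun i => c * a i).
Proof.
move=> [C C0 aC]; exists (c ^+ 2 * C); first by rewrite mulr_ge0// sqr_ge0.
move=> s us; have := ler_wpM2l (sqr_ge0 c) (aC s us).
by rewrite mulr_sumr; under [X in X <= _ -> _]eq_bigr do rewrite mulrA -exprMn.
Qed.

Lemma l2D (q : R) (a a' : mindex -> R) : l2 q a -> l2 q a' ->
  l2 q (fun i => a i + a' i).
Proof.
move=> [C C0 aC] [C' C'0 aC']; exists (2 * C + 2 * C').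
  by rewrite addr_ge0// mulr_ge0.
move=> s us.
apply: (@le_trans _ _ (2 * (\sum_(i <- s) a i ^+ 2 * weight (- q) i) +
  2 * (\sum_(i <- s) a' i ^+ 2 * weight (- q) i))).
  rewrite !mulr_sumr -big_split/=; apply: ler_sum => i _.
  rewrite !mulrA -mulrDl ler_wpM2r ?weight_ge0//.
  by have := sqr_ge0 (a i - a' i); nra.
by rewrite lerD// ler_wpM2l// ?aC ?aC'.
Qed.

(* By Cauchy-Schwarz, the square root of a supersolution for the squares is a
   supersolution. *)
Lemma l2_supersolution (q : R) (b : mindex -> R) (K : R) :
  0 < K -> (forall i, 0 <= b i) ->
  sums_le (fun i => b i * weight (- q / 2) i) K ->
  forall a, (forall i, 0 <= a i) -> l2 q a ->
  exists2 N, l2 q N & forall i, a i <= N i /\ convolution b N i <= 2 * K * N i.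
Proof.
move=> K0 b0 bK a a0 [C C0 aC].
pose W := @weight R (- q / 2).
have W0 i : 0 < W i by exact: weight_gt0.
(* With this factor, the weighted [b] satisfies b * Q <= 4 K Q. Cauchy-Schwarz then gives (b * sqrt
   Q)^2 <= K (b * Q) <= (2 K sqrt Q)^2, the origin of the constant [2 * K]. *)
have K4 : 0 <= (4 * K)^-1 by rewrite invr_ge0 mulr_ge0// ltW.
have [||||Q QC QP] := @l1_supersolution (fun i => b i * W i)
  (fun i => (a i * W i) ^+ 2) K C (4 * K)^-1 C0 K4 _ _ bK.
- by move=> i; rewrite mulr_ge0// ltW.
- by move=> i; rewrite sqr_ge0.
- move=> s us; apply: le_trans (aC s us); apply: ler_sum => i _.
  by rewrite exprMn weight_half.
- by rewrite (_ : 2 * _ = 1 / 2); [lra|field; rewrite gt_eqF].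
pose N i := Num.sqrt (Q i) / W i.
have Q0 i : 0 <= Q i by have [] := QP i.
have NW i : (N i * W i) ^+ 2 = Q i.
  by rewrite /N divfK ?gt_eqF// sqr_sqrtr.
have N0 i : 0 <= N i by rewrite divr_ge0 ?sqrtr_ge0// ltW.
have NW0 i : 0 <= N i * W i by rewrite mulr_ge0// ltW.
exists N.
  exists (2 * C); first by rewrite mulr_ge0.
  move=> s us; apply: le_trans (QC s us); apply: ler_sum => i _.
  by rewrite -weight_half -exprMn NW.
have cQ0 i : 0 <= convolution (fun i => b i * W i) Q i.
  by apply: conv_ge0 => // j; rewrite mulr_ge0// ltW.
move=> i; split.
  have aW0 : 0 <= a i * W i by rewrite mulr_ge0// ltW.
  rewrite -(ler_pM2r (W0 i)) -(@ler_pXn2r _ 2)// ?nnegrE ?NW0//.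
  by rewrite NW; have [_] := QP i; apply: le_trans; rewrite lerDl mulr_ge0.
rewrite -(ler_pM2r (W0 i)) -(@conv_weight b N (- q / 2) i).
have c0 : 0 <= convolution (fun j => b j * W j) (fun j => N j * W j) i.
  by apply: conv_ge0 => // j; rewrite mulr_ge0// ltW.
have KN0 : 0 <= 2 * K * N i * W i.
  by rewrite -[_ * W i]mulrA mulr_ge0// mulr_ge0// ltW.
rewrite -(@ler_pXn2r _ 2)//.
have := @weighted_cauchy_schwarz _ (below i) (fun j => b j * W j)
  (fun j => N (mindex_sub i j) * W (mindex_sub i j)) K K0.
move=> /(_ _ _)/le_trans; apply.
- by move=> j; rewrite mulr_ge0 ?(ltW (W0 j)).
- exact/bK/fset_uniq.
have -> : 2 * K * N i * W i = 2 * K * (N i * W i) by ring.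
rewrite exprMn NW; under eq_bigr do rewrite NW.
have [_] := QP i; rewrite -/(convolution (fun i => b i * W i) Q i) => H.
have {}H : (4 * K)^-1 * convolution (fun i => b i * W i) Q i <= Q i.
  by apply: le_trans H; rewrite lerDr sqr_ge0.
rewrite mulrC ler_pdivrMr in H; last by rewrite mulr_gt0.
have := ler_wpM2l (ltW K0) H; lra.
Qed.

End Weights.

(** * The coupled system *)

Section Picard.
Context {R : realType} {X : completeNormedModType R}.

Lemma half_geometric (C : R) : C * 2^-1 ^+ n @[n --> \oo] --> (0 : R).
Proof.
rewrite -[X in _ --> X](mulr0 C); apply: cvgMr; apply: cvg_expr.
by rewrite gtr0_norm ?invr_gt0// invf_lt1// ltr1n.
Qed.

Lemma le0_half_geometric (x C : R) : (forall n, x <= C * 2^-1 ^+ n) -> x <= 0.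
Proof.
move=> xC; apply: (ler_cvg_to (f := fun=> x) (cvg_cst x) (half_geometric C)).
by near=> n.
Unshelve. all: by end_near.
Qed.

Lemma geometric_increments (u : nat -> X) (C : R) : 0 <= C ->
  (forall n, `|u n.+1 - u n| <= C * 2^-1 ^+ n) ->
  forall n m, (n <= m)%N -> `|u m - u n| <= 2 * C * 2^-1 ^+ n.
Proof.
move=> C0 uC n m /subnKC <-; move: (m - n)%N => k {m}.
(* The induction needs the exact finite geometric sum; the bound [2^-1 ^+ n] alone does not
   reproduce itself. *)
suff : `|u (n + k)%N - u n| <= 2 * C * (2^-1 ^+ n - 2^-1 ^+ (n + k)).
  move=> H; apply: (le_trans H); rewrite ler_wpM2l ?mulr_ge0// gerBl exprn_ge0//.
elim: k => [|k IH]; first by rewrite addn0 !subrr normr0 mulr0.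
rewrite (_ : _ - _ = (u (n + k.+1)%N - u (n + k)%N) + (u (n + k)%N - u n)); last first.
  by rewrite addrA subrK.
apply: (le_trans (ler_normD _ _)); apply: (le_trans (lerD _ IH)).
  by rewrite addnS; exact: uC.
by rewrite addnS exprS le_eqVlt; apply/orP; left; apply/eqP; field.
Qed.

Lemma wick_opE (B : mindex -> X -> X) (u : mindex -> X) alpha :
  wick_op B u alpha =
  \sum_(beta <- below alpha) B beta (u (mindex_sub alpha beta)).
Proof. by rewrite /wick_op fsbig_finite//; exact: finite_mindex_le. Qed.

Context (B : mindex -> {linear X -> X}) (b : mindex -> R).
Hypotheses (contB : forall alpha, continuous (B alpha))
  (b0 : forall alpha, 0 <= b alpha)
  (boundB : forall alpha x, `|B alpha x| <= b alpha * `|x|).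

Lemma wick_op_le (u : mindex -> X) (x : mindex -> R) alpha :
  (forall beta, `|u beta| <= x beta) -> `|wick_op B u alpha| <= convolution b x alpha.
Proof.
move=> ux; rewrite wick_opE (le_trans (ler_norm_sum _ _ _))//.
apply: ler_sum => i _; apply: (le_trans (boundB _ _)).
by rewrite ler_wpM2l.
Qed.

Lemma wick_opB (u v : mindex -> X) alpha :
  wick_op B (fun i => u i - v i) alpha = wick_op B u alpha - wick_op B v alpha.
Proof.
by rewrite !wick_opE -sumrB; apply: eq_bigr => i _; rewrite linearB.
Qed.

Lemma continuous_wick_op (u : mindex -> R -> X) alpha :
  (forall beta, continuous (u beta)) ->
  continuous (fun t => wick_op B (u ^~ t) alpha).
Proof.
move=> cu; rewrite (_ : (fun t => _) = fun t =>
  \sum_(beta <- below alpha) B beta (u (mindex_sub alpha beta) t)); last first.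
  by apply/funext => t; rewrite wick_opE.
by move=> t; apply: cvg_sumr => i; apply: continuous_cvg; [exact: contB|exact: cu].
Qed.

Lemma right_derivative_wick_op (u v : mindex -> R -> X) alpha t :
  (forall beta, right_derivative (u beta) t (v beta t)) ->
  right_derivative (fun s => wick_op B (u ^~ s) alpha) t (wick_op B (v ^~ t) alpha).
Proof.
move=> uv; rewrite wick_opE (_ : (fun s => _) = fun s =>
  \sum_(beta <- below alpha) B beta (u (mindex_sub alpha beta) s)); last first.
  by apply/funext => s; rewrite wick_opE.
by apply: right_derivative_sum => i; apply: right_derivative_linear => //; exact: contB.
Qed.

Context (S : mindex -> R -> {linear X -> X}) (M w : R).
Hypotheses (semiS : forall alpha, C0_semigroup (S alpha)) (M0 : 0 < M) (w0 : 0 < w).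
Hypothesis boundS : forall alpha t x, 0 <= t ->
  `|S alpha t x| <= M * expR (w * t) * `|x|.
Context (kappa : R) (kappa0 : 0 < kappa).

(** Chosen so that [M * kappa / (rate - w) = 1 / 2], the contraction ratio delivered by
    [duhamel_le]. *)
Definition rate : R := w + 2 * M * kappa.

Lemma rate_gt : w < rate.
Proof. by rewrite /rate ltrDl !mulr_gt0. Qed.

Lemma duhamel_rate_le alpha (h : R -> X) (C t : R) : 0 <= t -> continuous h ->
  0 <= C -> (forall s, 0 <= s <= t -> `|h s| <= kappa * C * expR (rate * s)) ->
  `|duhamel (S alpha) h t| <= C / 2 * expR (rate * t).
Proof.
move=> t0 ch C0 hC.
have := @duhamel_le R X (S alpha) M w (semiS alpha) M0 w0 (boundS alpha) h t rate
  (kappa * C) t0 rate_gt ch (mulr_ge0 (ltW kappa0) C0) hC.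
rewrite (_ : M * _ / _ = C / 2)// /rate addrAC subrr add0r; field.
by rewrite !gt_eqF.
Qed.

(* In the norm sup_t |v_alpha(t)| exp (- rate t) / N_alpha the integral operator
   of the iteration is a contraction of ratio 1/2. *)
Lemma mild_solution_exists (N : mindex -> R) (y : mindex -> X) (F : mindex -> R -> X)
    (c : R) : 0 <= c -> (forall alpha, 0 <= N alpha) ->
  (forall alpha, convolution b N alpha <= kappa * N alpha) ->
  (forall alpha, `|y alpha| <= c * N alpha) ->
  (forall alpha, continuous (F alpha)) ->
  (forall alpha t, `|F alpha t| <= c * N alpha) ->
  exists v : mindex -> R -> X,
    [/\ forall alpha, continuous (v alpha),
      forall alpha t, 0 <= t -> v alpha t = S alpha t (y alpha) +
        duhamel (S alpha) (fun s => F alpha s + wick_op B (v ^~ s) alpha) t &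
      exists2 C, 0 <= C &
        forall alpha t, 0 <= t -> `|v alpha t| <= C * N alpha * expR (rate * t)].
Proof.
move=> c0 N0 bN yN cF FN.
pose h (v : mindex -> R -> X) alpha s := F alpha s + wick_op B (v ^~ s) alpha.
(* At negative times the iterates keep their value at 0; they are then continuous on the whole line
   and [duhamel] applies to them. *)
pose v := fix v n alpha (t : R) := if n is m.+1 then
  S alpha (Num.max t 0) (y alpha) + duhamel (S alpha) (h (v m) alpha) (Num.max t 0)
  else 0.
have ch u alpha : (forall beta, continuous (u beta)) -> continuous (h u alpha).
  move=> cu t; apply: cvgD; first exact: cF.
  exact: continuous_wick_op.
have cv n alpha : continuous (v n alpha).
  elim: n alpha => [|n IH] alpha t /=; first exact: cvg_cst.
  apply: cvgD.
    exact: (semigroup_continuous (semiS alpha) M0 w0 (boundS alpha)).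
  by apply: (continuous_duhamel (semiS alpha) M0 w0 (boundS alpha)); exact: ch.
have vS n alpha t : 0 <= t -> v n.+1 alpha t =
    S alpha t (y alpha) + duhamel (S alpha) (h (v n) alpha) t.
  by move=> t0; rewrite /= (max_idPl t0).
have vmax n alpha t : v n alpha t = v n alpha (Num.max t 0).
  by case: n => //= n; rewrite (max_idPl (_ : 0 <= Num.max t 0))// le_max lexx orbT.
(* Bound of the first iterate: [M * c] from the initial value, the rest from the Duhamel integral of
   [F]. *)
pose C := M * c + M * c / (rate - w).
have rw : 0 < rate - w by rewrite subr_gt0 rate_gt.
have rate0 : 0 < rate by rewrite (lt_trans w0 rate_gt).
have C0 : 0 <= C by rewrite addr_ge0// ?divr_ge0 ?mulr_ge0// ltW.
have wick_le (u : mindex -> X) (z : R) alpha :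
    (forall beta, `|u beta| <= z * N beta) -> 0 <= z ->
    `|wick_op B u alpha| <= kappa * (z * N alpha).
  move=> uz z0; apply: (le_trans (@wick_op_le u (fun i => z * N i) alpha uz)).
  by rewrite convZ mulrCA ler_wpM2l.
have incr n alpha t : 0 <= t ->
    `|v n.+1 alpha t - v n alpha t| <= C * N alpha * expR (rate * t) * 2^-1 ^+ n.
  elim: n alpha t => [|n IH] alpha t t0.
    rewrite vS// subr0 expr0 mulr1 (le_trans (ler_normD _ _))//.
    rewrite /C 2!mulrDl lerD//.
      apply: (le_trans (boundS _ _ t0)).
      rewrite -!mulrA ler_wpM2l ?(ltW M0)// mulrC mulrA ler_pM ?expR_ge0//.
      by rewrite ler_expR ler_wpM2r// ltW// rate_gt.
    apply: le_trans (duhamel_le (semiS alpha) M0 w0 (boundS alpha) t0 rate_gt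
      (C := c * N alpha) _ _ _) _.
    - by apply: ch => beta; exact: cv.
    - by rewrite mulr_ge0.
    - move=> s /andP[s0 _]; rewrite /h /wick_op.
      rewrite (_ : \sum_(_ \in _) _ = 0); last first.
        by apply: fsbig1 => i _; rewrite linear0.
      rewrite addr0; apply: (le_trans (FN _ _)).
      by rewrite ler_peMr ?mulr_ge0// -[leLHS]expR0 ler_expR mulr_ge0// ltW.
    by rewrite le_eqVlt; apply/orP; left; apply/eqP; ring.
  rewrite (vS n.+1)// (vS n)// opprD addrACA subrr add0r.
  rewrite -(duhamelB (semiS alpha) M0 w0 (boundS alpha) t0); last 2 first.
    by apply: ch => beta; exact: cv.
    by apply: ch => beta; exact: cv.
  apply: le_trans (duhamel_rate_le (C := C * N alpha * 2^-1 ^+ n) alpha t0 _ _ _) _.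
  - by move=> s; apply: cvgB; apply: ch => beta; exact: cv.
  - by rewrite !mulr_ge0// exprn_ge0.
  - move=> s /andP[s0 _]; rewrite /h opprD addrACA subrr add0r -wick_opB.
    apply: le_trans (wick_le _ (C * expR (rate * s) * 2^-1 ^+ n) _ _ _) _.
    + move=> beta; apply: (le_trans (IH _ _ s0)).
      by rewrite le_eqVlt; apply/orP; left; apply/eqP; ring.
    + by rewrite !mulr_ge0 ?expR_ge0// exprn_ge0.
    + by rewrite le_eqVlt; apply/orP; left; apply/eqP; ring.
  - by rewrite exprS le_eqVlt; apply/orP; left; apply/eqP; field.
have E0 alpha t : 0 <= C * N alpha * expR (rate * t).
  by rewrite !mulr_ge0// expR_ge0.
have lim alpha t : exists l : X, 0 <= t -> v n alpha t @[n --> \oo] --> l /\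
    forall n, `|l - v n alpha t| <= 2 * (C * N alpha * expR (rate * t)) * 2^-1 ^+ n.
  have [t0|_] := leP 0 t; last by exists 0.
  have [||l vl lv] := @cauchy_rate R X (fun n => v n alpha t)
    (fun n => 2 * (C * N alpha * expR (rate * t)) * 2^-1 ^+ n) 0%N.
  - exact: half_geometric.
  - move=> n m _; exact: (@geometric_increments (fun n => v n alpha t) _
      (E0 alpha t) (fun k => incr k alpha t t0) n m).
  - by exists l => _; split=> // n; exact: lv.
have /choice[L LP] : forall i : mindex * R, exists l : X, 0 <= i.2 ->
    v n i.1 i.2 @[n --> \oo] --> l /\
    forall n, `|l - v n i.1 i.2| <= 2 * (C * N i.1 * expR (rate * i.2)) * 2^-1 ^+ n.
  by move=> [alpha t]; exact: lim.
pose V alpha t := L (alpha, Num.max t 0).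
have max0 (t : R) : 0 <= Num.max t 0 by rewrite le_max lexx orbT.
have VP alpha t n : `|V alpha t - v n alpha t| <=
    2 * (C * N alpha * expR (rate * Num.max t 0)) * 2^-1 ^+ n.
  by rewrite vmax; have [_] := LP (alpha, Num.max t 0) (max0 t); apply.
(* The exponential is bounded for times up to [|t| + 1], so the convergence is uniform there and the
   limit is continuous. *)
have cV alpha : continuous (V alpha).
  move=> t; apply/cvgrPdist_le => e e0.
  have e3 : 0 < e / 3 by rewrite divr_gt0.
  pose K := 2 * (C * N alpha * expR (rate * (`|t| + 1))).
  have /cvgrPdist_le/(_ _ e3) [n _ /(_ n (leqnn n))/=] := half_geometric K.
  rewrite sub0r normrN => /(le_trans (ler_norm _)) Kn.
  have VK s : s <= `|t| + 1 -> `|V alpha s - v n alpha s| <= e / 3.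
    move=> st; apply: le_trans (VP _ _ n) (le_trans _ Kn).
    rewrite ler_wpM2r ?exprn_ge0// ler_wpM2l// ler_wpM2l ?mulr_ge0//.
    by rewrite ler_expR ler_wpM2l ?(ltW rate0)// ge_max st addr_ge0.
  have near1 : \forall s \near t, s <= `|t| + 1.
    near=> s; have : `|t - s| <= 1 by near: s; apply: cvgr_dist_le.
    by rewrite ler_norml; have := ler_norm t; lra.
  near=> s.
  rewrite (_ : V alpha t - V alpha s = (V alpha t - v n alpha t) +
    ((v n alpha t - v n alpha s) + (v n alpha s - V alpha s))); last first.
    by rewrite !addrA !subrK.
  rewrite (le_trans (ler_normD _ _))// (_ : e = e / 3 + (e / 3 + e / 3)); last by field.
  rewrite lerD//; first by apply: VK; rewrite (le_trans (ler_norm t))// lerDl.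
  rewrite (le_trans (ler_normD _ _))// lerD//.
    by near: s; move/cvgrPdist_le : (cv n alpha t); apply.
  by rewrite distrC VK//; near: s.
exists V; split=> //.
  move=> alpha t t0; apply/eqP; rewrite -subr_eq0 -normr_le0.
  pose Q := 2 * (C * N alpha * expR (rate * t)).
  apply: (@le0_half_geometric _ (2 * Q)) => n.
  (* Both [V - v n.+1] and the image of [v n - V] under the integral operator are of order
     [2^-1 ^+ n], so the defect in the equation is 0. *)
  rewrite -/(h V alpha) (_ : V alpha t - _ = (V alpha t - v n.+1 alpha t) +
    duhamel (S alpha) (fun s => h (v n) alpha s - h V alpha s) t); last first.
    rewrite (duhamelB (semiS alpha) M0 w0 (boundS alpha) t0); last 2 first.
      by apply: ch => beta; exact: cv.
      exact: ch.
    by rewrite vS// !opprD !addrA subrK.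
  rewrite (le_trans (ler_normD _ _))//.
  rewrite (_ : 2 * Q * _ = Q * 2^-1 ^+ n + Q * 2^-1 ^+ n); last by ring.
  apply: lerD.
    have := VP alpha t n.+1; rewrite (max_idPl t0) -/Q => /le_trans; apply.
    rewrite ler_wpM2l ?mulr_ge0 ?E0// exprS ler_piMl ?exprn_ge0//.
    by rewrite invf_le1// ler1n.
  apply: le_trans (duhamel_rate_le (C := 2 * (C * N alpha) * 2^-1 ^+ n) alpha t0 _ _ _) _.
  - by move=> s; apply: cvgB; apply: ch => beta; [exact: cv|exact: cV].
  - by rewrite !mulr_ge0// exprn_ge0.
  - move=> s /andP[s0 _]; rewrite /h opprD addrACA subrr add0r -wick_opB.
    apply: le_trans (wick_le _ (2 * (C * expR (rate * s)) * 2^-1 ^+ n) _ _ _) _.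
    + move=> beta; rewrite distrC; apply: (le_trans (VP _ _ n)).
      rewrite (max_idPl s0).
      by rewrite le_eqVlt; apply/orP; left; apply/eqP; ring.
    + by rewrite !mulr_ge0 ?expR_ge0// exprn_ge0.
    + by rewrite le_eqVlt; apply/orP; left; apply/eqP; ring.
  - rewrite (_ : _ * _ = Q * 2^-1 ^+ n / 2); last by rewrite /Q; field.
    by rewrite ler_pdivrMr// ler_peMr ?ler1n// mulr_ge0 ?exprn_ge0// mulr_ge0 ?E0.
exists (2 * C); first by rewrite mulr_ge0.
move=> alpha t t0; have := VP alpha t 0%N.
by rewrite subr0 expr0 mulr1 (max_idPl t0) !mulrA.
Unshelve. all: by end_near.
Qed.

(** The function r -> S(t - r) W(r) runs from S(t) W(0) = 0 to W(t), and its right derivative is S(t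
    - r) (B <> W)(r), the generator having cancelled. Integrating the bound of stage [n] halves it;
    the a priori bound by [N] starts the iteration. *)
Lemma homogeneous_solution_eq0 (N : mindex -> R) (W : mindex -> R -> X) (T : R) :
  (forall alpha, convolution b N alpha <= kappa * N alpha) ->
  (forall alpha, continuous (W alpha)) -> (forall alpha, W alpha 0 = 0) ->
  (forall alpha t, 0 <= t <= T -> `|W alpha t| <= N alpha) ->
  (forall alpha s, 0 < s < T -> exists z z', [/\ right_derivative (W alpha) s z,
    right_derivative (S alpha ^~ (W alpha s)) 0 z' &
    z - z' = wick_op B (W ^~ s) alpha]) ->
  forall alpha t, 0 <= t <= T -> W alpha t = 0.
Proof.
move=> bN cW W00 WN WE.
have rw : 0 < rate - w by rewrite subr_gt0 rate_gt.
have rate0 : 0 < rate by rewrite (lt_trans w0 rate_gt).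
suff key n alpha t : 0 <= t <= T ->
    `|W alpha t| <= N alpha * expR (rate * t) * 2^-1 ^+ n.
  move=> alpha t tT; apply/eqP; rewrite -normr_le0.
  by apply: (@le0_half_geometric _ (N alpha * expR (rate * t))) => n; exact: key.
elim: n alpha t => [|n IH] alpha t /andP[t0 tT].
  have NW : `|W alpha t| <= N alpha by apply: WN; rewrite t0.
  rewrite expr0 mulr1 (le_trans NW)// ler_peMr ?(le_trans _ NW)//.
  by rewrite -[leLHS]expR0 ler_expR mulr_ge0// ltW.
pose K := M * (kappa * N alpha * 2^-1 ^+ n) * expR (w * t) / (rate - w).
have N0 : 0 <= N alpha.
  by apply: le_trans (WN alpha t _); rewrite ?t0.
have K0 : 0 <= K.
  by rewrite /K !mulr_ge0 ?expR_ge0 ?exprn_ge0 ?invr_ge0// ltW.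
(* [psi] is the majorant M e^(w (t - s)) kappa N_alpha 2^-n e^(rate s) of that derivative, written
   as a multiple of e^((rate - w) s) so that its antiderivative [phi] is explicit. *)
pose phi (s : R) : R^o := K * expR ((rate - w) * s).
pose psi (s : R) : R^o := K * (rate - w) * expR ((rate - w) * s).
have dphi (s : R) : is_derive s (1 : R) phi (psi s).
  by rewrite /phi /psi; apply: is_derive_eq; rewrite /GRing.scale/= mulr1; ring.
have cphi : continuous phi.
  move=> s; apply: differentiable_continuous; apply/derivable1_diffP.
  exact: (@ex_derive _ _ _ _ _ _ _ (dphi s)).
have [cS S0 _ _] := semiS alpha.
have := @mean_value_ineq R X (fun r => S alpha (Num.max (t - r) 0) (W alpha r))
  (fun s => S alpha (t - s) (wick_op B (W ^~ s) alpha)) phi psi 0 t t0.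
rewrite subr0 subrr maxxx (max_idPl t0) S0 W00 linear0 subr0 => H.
apply: (le_trans (H _ cphi _ _ _)).
- apply: (semigroup_comp_continuous (semiS alpha) M0 w0 (boundS alpha)) => //.
  by move=> s; apply: cvgB; [exact: cvg_cst|exact: cvg_id].
- move=> s /andP[s0 st].
  have [|z [z' [dz dz' <-]]] := WE alpha s; first by rewrite s0 (lt_le_trans st).
  exact: (semigroup_product_right_derivative (semiS alpha) M0 w0 (boundS alpha)).
- by move=> s _; exact: right_derivative_is_derive.
- move=> s /andP[s0 st].
  have ts : 0 <= t - s by rewrite subr_ge0 ltW.
  apply: (le_trans (boundS _ _ ts)).
  have wickW : `|wick_op B (W ^~ s) alpha| <=
      kappa * N alpha * 2^-1 ^+ n * expR (rate * s).
    apply: (le_trans (@wick_op_le _ (fun i => expR (rate * s) * 2^-1 ^+ n * N i) _ _)).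
      move=> beta; apply: (le_trans (IH beta s _)).
        by rewrite (ltW s0) ltW// (lt_le_trans st).
      by rewrite le_eqVlt; apply/orP; left; apply/eqP; ring.
    rewrite convZ (_ : kappa * _ * _ * _ =
      expR (rate * s) * 2^-1 ^+ n * (kappa * N alpha)); last by ring.
    by rewrite ler_wpM2l// mulr_ge0 ?expR_ge0// exprn_ge0.
  have -> : psi s = M * expR (w * (t - s)) *
      (kappa * N alpha * 2^-1 ^+ n * expR (rate * s)).
    rewrite /psi /K divfK ?gt_eqF//.
    transitivity (M * (kappa * N alpha * 2^-1 ^+ n) *
      (expR (w * t) * expR ((rate - w) * s))).
      by ring.
    transitivity (M * (kappa * N alpha * 2^-1 ^+ n) *
      (expR (w * (t - s)) * expR (rate * s))).
      by rewrite -!expRD; congr (_ * expR _); ring.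
    by ring.
  by rewrite ler_wpM2l// mulr_ge0 ?expR_ge0// ltW.
- apply: (@le_trans _ _ (phi t)).
    by rewrite gerBl /phi mulr_ge0 ?expR_ge0.
  have -> : phi t = M * (kappa * N alpha * 2^-1 ^+ n) / (rate - w) *
      (expR (w * t) * expR ((rate - w) * t)) by rewrite /phi /K; ring.
  rewrite -expRD (_ : w * t + _ = rate * t); last by ring.
  rewrite exprS le_eqVlt; apply/orP; left; apply/eqP.
  rewrite /rate addrAC subrr add0r; field.
  by rewrite !gt_eqF.
Qed.

End Picard.

(** * From extended sums to finite partial sums and back *)

Section Expansions.
Context {R : realType}.

Lemma esum_sums_le (x : mindex -> \bar R) : (forall i, (0 <= x i)%E) ->
  (\esum_(i in [set: mindex]) x i < +oo)%E ->
  (forall i, x i \is a fin_num) /\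
  exists2 C, 0 <= C & sums_le (fun i => fine (x i)) C.
Proof.
move=> x0 xoo.
have E0 : (0 <= \esum_(i in [set: mindex]) x i)%E by exact: esum_ge0.
have Efin : (\esum_(i in [set: mindex]) x i)%E \is a fin_num.
  by rewrite ge0_fin_numE.
have sumE s : uniq s -> (\sum_(i <- s) x i <= \esum_(i in [set: mindex]) x i)%E.
  move=> us; apply: esum_ge; exists [set` s]; first by split=> //; exact: finite_seq.
  by rewrite fsbig_seq.
have xfin i : x i \is a fin_num.
  rewrite ge0_fin_numE//; apply: le_lt_trans xoo.
  by have := sumE [:: i] isT; rewrite big_seq1.
split=> //; exists (fine (\esum_(i in [set: mindex]) x i)%E); first exact: fine_ge0.
move=> s us; rewrite -lee_fin fineK// -sumEFin; apply: le_trans (sumE s us).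
by under eq_bigr do rewrite fineK//.
Qed.

Lemma sums_le_esum (x : mindex -> R) (C : R) : sums_le x C ->
  (\esum_(i in [set: mindex]) (x i)%:E <= C%:E)%E.
Proof.
move=> xC; apply: ge_ereal_sup => _ [A [finA _] <-].
by rewrite fsbig_finite// sumEFin lee_fin xC// fset_uniq.
Qed.

(** The weight is positive, so an infinite norm would make its own term infinite; hence every
    coefficient has a real norm. *)
Lemma kondratiev_l2 (Y : Type) (P : set Y) (norm : Y -> \bar R) (q : R)
    (u : mindex -> Y) : (forall i, (0 <= norm (u i))%E) -> kondratiev P norm q u ->
  (forall i, norm (u i) \is a fin_num) /\ l2 q (fun i => fine (norm (u i))).
Proof.
move=> n0 [_ H].
have [|fin [C C0 HC]] := esum_sums_le _ H.
  by move=> i; rewrite mule_ge0// ?lee_fin ?weight_ge0// expe2 mule_ge0.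
have nfin i : norm (u i) \is a fin_num.
  rewrite ge0_fin_numE// ltey; apply: contraTneq (fin i) => ->.
  by rewrite expe2 mulyy gt0_mulye// lte_fin weight_gt0.
split=> //; exists C => // s us; apply: le_trans (HC s us).
by apply: ler_sum => i _; rewrite -(fineK (nfin i)) -EFin_expe -EFinM.
Qed.

Lemma l2_kondratiev (Y : Type) (P : set Y) (norm : Y -> \bar R) (q : R)
    (u : mindex -> Y) (a : mindex -> R) : (forall i, P (u i)) ->
  (forall i, (0 <= norm (u i) <= (a i)%:E)%E) -> l2 q a -> kondratiev P norm q u.
Proof.
move=> Pu na [C _ aC]; split=> //; apply: (@le_lt_trans _ _ C%:E); last exact: ltry.
apply: le_trans (sums_le_esum aC); apply: le_esum => i _.
have /andP[n0 nai] := na i.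
rewrite EFinM lee_wpmul2r ?lee_fin ?weight_ge0// EFin_expe !expe2.
by apply: lee_pmul.
Qed.

End Expansions.

(** * Derivatives and norms on intervals *)

Section Intervals.
Context {R : realType} {X : completeNormedModType R}.

Lemma sup_norm_ge0 (I : set R) (u : R -> X) : I !=set0 -> (0 <= sup_norm I u)%E.
Proof.
move=> [t It]; apply: (@le_trans _ _ (`|u t|%:E)); first by rewrite lee_fin.
by apply: ereal_sup_ubound; exists t.
Qed.

Lemma sup_norm_le (I : set R) (u : R -> X) (C : R) :
  (forall t, I t -> `|u t| <= C) -> (sup_norm I u <= C%:E)%E.
Proof. by move=> uC; apply: ge_ereal_sup => _ [t It <-]; rewrite lee_fin uC. Qed.

Lemma le_sup_norm (I : set R) (u : R -> X) (t : R) : I t ->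
  (`|u t|%:E <= sup_norm I u)%E.
Proof. by move=> It; apply: ereal_sup_ubound; exists t. Qed.

(** This makes the limit in [derive_within] unique. Room on one side of [t] is enough, on the right
    if [t < b] and on the left if [t = b], so endpoints are covered. *)
Lemma proper_within_interval (I : set R) (a b t : R) : a < b -> a <= t <= b ->
  (forall s, a < s < b -> I s) ->
  ProperFilter (within [set h | I (t + h)] 0^').
Proof.
move=> ab /andP[at_ tb] HI; apply: Build_ProperFilter_ex.
move=> A [e /= e0 HA].
have [tb'|bt] := ltP t b.
  pose k := Num.min (e / 2) ((b - t) / 2).
  have k0 : 0 < k by rewrite lt_min !divr_gt0// subr_gt0.
  have [ke kb] : k <= e / 2 /\ k <= (b - t) / 2.
    by split; rewrite /k ge_min lexx ?orbT.
  exists k; apply: HA => /=.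
  - by rewrite sub0r normrN gtr0_norm//; lra.
  - by rewrite gt_eqF.
  - by apply: HI; lra.
pose k := Num.min (e / 2) ((b - a) / 2).
have k0 : 0 < k by rewrite lt_min !divr_gt0// subr_gt0.
have [ke kb] : k <= e / 2 /\ k <= (b - a) / 2.
  by split; rewrite /k ge_min lexx ?orbT.
exists (- k); apply: HA => /=.
- by rewrite sub0r opprK gtr0_norm//; lra.
- by rewrite oppr_eq0 gt_eqF.
- by apply: HI; lra.
Qed.

Lemma derivative_within (I : set R) (u : R -> X) (t : R) (d : X) :
  derivative u t d ->
  diffquo u t h @[h --> within [set h | I (t + h)] 0^'] --> d.
Proof. by move=> du; apply: cvg_trans du; apply: cvg_app; exact: cvg_within. Qed.

Lemma derive_withinE (I : set R) (u : R -> X) (a b t : R) (d : X) : a < b ->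
  a <= t <= b -> (forall s, a < s < b -> I s) -> derivative u t d ->
  derive_within I u t = d.
Proof.
move=> ab tab HI du; have PF := proper_within_interval ab tab HI.
by apply: cvg_lim; [exact: norm_hausdorff|exact: derivative_within].
Qed.

Lemma right_derivative_within (I : set R) (u : R -> X) (t b : R) (d : X) : t < b ->
  (forall s, t < s < b -> I s) ->
  diffquo u t h @[h --> within [set h | I (t + h)] 0^'] --> d ->
  right_derivative u t d.
Proof.
move=> tb HI du; apply: cvg_trans du; apply: cvg_app => A [e /= e0 HA].
exists (Num.min e (b - t)) => /=; first by rewrite lt_min e0 subr_gt0.
move=> h /=; rewrite sub0r normrN lt_min => /andP[he hb] h0.
apply: HA => /=; first by rewrite sub0r normrN.
- by rewrite gt_eqF.
- by apply: HI; rewrite gtr0_norm// in hb; lra.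
Qed.

Lemma C1_on_derivative (a b : R) (u v : R -> X) : a < b -> continuous v ->
  (forall t, derivative u t (v t)) -> C1_on `[a, b] u.
Proof.
move=> ab cv du.
have I s : a < s < b -> `[a, b]%classic s.
  by move=> /andP[? ?]; rewrite /= in_itv/= !ltW.
split.
- by apply: continuous_subspaceT => t; apply: derivative_continuous; exact: du.
- by move=> t _; apply/cvg_ex; exists (v t); exact: derivative_within.
- have E t : t \in `[a, b]%classic -> v t = derive_within `[a, b] u t.
    rewrite inE/= in_itv/= => tab.
    by apply/esym; exact: (derive_withinE ab tab I).
  by apply: (subspace_eq_continuous (f := v)) => //; exact: continuous_subspaceT.
Qed.

(** Composition with this projection extends a function on [[0, T]] by its end values; continuity
    within [[0, T]] becomes continuity on the whole line, and [primitive] can be applied. *)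
Definition clamp (T t : R) : R := Num.max 0 (Num.min t T).

Lemma clampE (T t : R) : 0 <= t <= T -> clamp T t = t.
Proof. by move=> /andP[t0 tT]; rewrite /clamp (min_idPl tT) (max_idPr t0). Qed.

Lemma clamp_itv (T t : R) : 0 <= T -> 0 <= clamp T t <= T.
Proof. by move=> T0; rewrite /clamp le_max lexx/= ge_max T0 ge_min lexx orbT. Qed.

Lemma continuous_clamp (T : R) : continuous (clamp T).
Proof.
move=> t; apply: (@continuous_max _ _ (cst 0) (fun t => Num.min t T)).
  exact: cvg_cst.
by apply: continuous_min; [exact: cvg_id|exact: cvg_cst].
Qed.

Lemma continuous_comp_clamp (T : R) (u : R -> X) : 0 <= T ->
  {within `[0, T], continuous u} -> continuous (fun t => u (clamp T t)).
Proof.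
move=> T0 /subspace_continuousP cu t.
have cT s : `[0, T]%classic (clamp T s) by rewrite /= in_itv/= clamp_itv.
have := cu _ (cT t); apply: cvg_trans => A /= [e /= e0 HA].
have /cvgrPdist_lt/(_ _ e0)[d /= d0 Hd] := @continuous_clamp T t.
by exists d => // s /= ts; apply: HA; [exact: Hd|exact: cT].
Qed.

Lemma right_derivative_comp_clamp (T t : R) (u : R -> X) (d : X) : 0 <= t < T ->
  right_derivative u t d -> right_derivative (fun s => u (clamp T s)) t d.
Proof.
move=> /andP[t0 tT] /right_derivativeP du; apply/right_derivativeP => e /du.
move=> /near_at_right0[r r0 Hr]; apply/near_at_right0.
exists (Num.min r (T - t)); first by rewrite lt_min r0 subr_gt0.
move=> k; rewrite lt_min => /and3P[k0 kr kT].
by rewrite !clampE ?Hr ?k0//; lra.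
Qed.

End Intervals.

(** * Construction of the solution, and uniqueness across exponents *)

Theorem theorem3p2 (R : realType) (X : completeNormedModType R)
  (T : R) (T_gt0 : 0 < T)
  (D : set X) (D_dense : dense D)
  (A : mindex -> X -> X) (S : mindex -> R -> {linear X -> X})
  (S_semigroup : forall alpha, C0_semigroup (S alpha))
  (A_generator : forall alpha, is_generator D (A alpha) (S alpha))
  (M w : R) (M_gt0 : 0 < M) (w_gt0 : 0 < w)
  (S_bound : forall alpha t, 0 <= t ->
     (op_norm (S alpha t) <= (M * expR (w * t))%:E)%E)
  (B : mindex -> {linear X -> X})
  (B_bounded : forall alpha, continuous (B alpha))
  (p : R) (p_gt0 : 0 < p)
  (B_summable : (\esum_(alpha in [set: mindex])
     (op_norm (B alpha) * (weight (- p / 2) alpha)%:E) < +oo)%E)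
  (u0 : mindex -> X) (u0_Dom : Dom D A u0)
  (u0_summable : kondratievX p u0)
  (Au0_summable : kondratievX p (coord_op A u0))
  (f : mindex -> R -> X)
  (f_C1 : kondratiev (C1_on `[0, T]) (C1_norm `[0, T]) p f) :
  exists U : mindex -> R -> X,
    [/\ kondratiev (C1_on `[0, T]) (C1_norm `[0, T]) p U,
        is_solution T D A B f u0 U &
        forall V : mindex -> R -> X, is_solution T D A B f u0 V ->
          forall alpha t, 0 <= t <= T -> V alpha t = U alpha t].
Proof.
have boundS alpha t x : 0 <= t -> `|S alpha t x| <= M * expR (w * t) * `|x|.
  by move=> t0; apply: op_norm_le; exact: S_bound.
have opB0 alpha : (0 <= op_norm (B alpha))%E.
  by apply: ereal_sup_ubound; exists 0; rewrite /= ?linear0 normr0.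
have [|BWfin [C0 C00 BWC]] := esum_sums_le _ B_summable.
  by move=> i; rewrite mule_ge0// lee_fin weight_ge0.
have opBfin alpha : op_norm (B alpha) \is a fin_num.
  rewrite ge0_fin_numE// ltey; apply: contraTneq (BWfin alpha) => ->.
  by rewrite gt0_mulye// lte_fin weight_gt0.
pose b alpha := fine (op_norm (B alpha)).
have b0 alpha : 0 <= b alpha by exact: fine_ge0.
have boundB alpha x : `|B alpha x| <= b alpha * `|x|.
  by apply: op_norm_le; rewrite fineK.
(* Adding 1 keeps [K] positive even when every [B alpha] vanishes. *)
pose K := C0 + 1; have K0 : 0 < K by rewrite ltr_wpDl.
have bK : sums_le (fun i => b i * weight (- p / 2) i) K.
  move=> s us; apply: (@le_trans _ _ C0); last by rewrite lerDl.
  apply: le_trans (BWC s us); apply: ler_sum => i _.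
  by rewrite fineM.
pose kappa := 2 * K; have kappa0 : 0 < kappa by rewrite mulr_gt0.
have T0 := ltW T_gt0.
have itvT t : 0 <= t <= T -> `[0, T]%classic t by rewrite /= in_itv.
have I0 : `[0, T]%classic !=set0 by exists 0; apply: itvT; rewrite lexx.
have norm0 alpha : (0 <= C1_norm `[0%R, T] (f alpha))%E.
  by rewrite adde_ge0// sup_norm_ge0.
have [f_on _] := f_C1.
have [ffin l2f] := kondratiev_l2 norm0 f_C1.
pose nf alpha := fine (C1_norm `[0, T] (f alpha)).
have nfE alpha : (nf alpha)%:E = C1_norm `[0, T] (f alpha) by rewrite fineK.
have f_le alpha t : 0 <= t <= T -> `|f alpha t| <= nf alpha.
  move=> /itvT tT; rewrite -lee_fin nfE.
  by apply: le_trans (le_sup_norm _ tT) _; rewrite leeDl// sup_norm_ge0.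
have f'_le alpha t : 0 <= t <= T -> `|derive_within `[0, T] (f alpha) t| <= nf alpha.
  move=> /itvT tT; rewrite -lee_fin nfE.
  by apply: le_trans (le_sup_norm _ tT) _; rewrite leeDr// sup_norm_ge0.
(* The derivative of [f], continued beyond [[0, T]] by its end values: the forcing term of the
   equation for v. *)
pose fc alpha t := derive_within `[0, T] (f alpha) (clamp T t).
have cfc alpha : continuous (fc alpha).
  by apply: continuous_comp_clamp => //; case: (f_on alpha).
have fE alpha t : 0 <= t <= T -> f alpha t = f alpha 0 + primitive (fc alpha) t.
  move=> /[dup] tT /andP[t0 tT'].
  have := @primitive_unique R X (fun s => f alpha (clamp T s)) (fc alpha) t t0.
  rewrite !clampE ?lexx//; apply=> //.
    by apply: continuous_comp_clamp => //; case: (f_on alpha).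
  move=> s /andP[s0 st]; have sT := lt_le_trans st tT'.
  apply: right_derivative_comp_clamp; first by rewrite sT ltW.
  have sI : 0 <= s <= T by rewrite !ltW.
  have [_ /(_ s (itvT _ sI)) df _] := f_on alpha.
  rewrite /fc clampE//; apply: (right_derivative_within sT _ df) => r /andP[sr rT].
  by apply: itvT; rewrite !ltW// (lt_trans s0).
have xfin0 (u : mindex -> X) i : (0 <= `|u i|%:E)%E by rewrite lee_fin.
have [_ l2u0] := kondratiev_l2 (xfin0 u0) u0_summable.
have [_ l2Au0] := kondratiev_l2 (xfin0 (coord_op A u0)) Au0_summable.
(* One majorant has to dominate all the data: [u0], [A u0], and [f] with its derivative. *)
pose a alpha := `|u0 alpha| + `|A alpha (u0 alpha)| + nf alpha.
have nf0 alpha : 0 <= nf alpha by exact: fine_ge0.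
have [||N l2N NP] := @l2_supersolution R p b K K0 b0 bK a.
- by move=> i; rewrite !addr_ge0.
- by apply: l2D => //; exact: l2D.
have aN alpha : a alpha <= N alpha by have [] := NP alpha.
have bN alpha : convolution b N alpha <= kappa * N alpha by have [] := NP alpha.
have N0 alpha : 0 <= N alpha.
  by apply: le_trans (aN alpha); rewrite !addr_ge0.
have u0N alpha : `|u0 alpha| <= N alpha.
  apply: le_trans (aN alpha); rewrite /a -addrA lerDl addr_ge0//.
have Au0N alpha : `|A alpha (u0 alpha)| <= N alpha.
  apply: le_trans (aN alpha); rewrite /a [_ + `|A _ _|]addrC -addrA lerDl addr_ge0//.
have nfN alpha : nf alpha <= N alpha.
  by apply: le_trans (aN alpha); rewrite /a lerDr addr_ge0.
have wick_le (u : mindex -> X) z alpha : 0 <= z -> (forall i, `|u i| <= z * N i) ->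
    `|wick_op B u alpha| <= kappa * z * N alpha.
  move=> z0 uz; apply: (le_trans (wick_op_le b0 boundB alpha uz)).
  by rewrite convZ [kappa * z]mulrC -mulrA ler_wpM2l.
pose g0 alpha := f alpha 0 + wick_op B u0 alpha.
have T00 : 0 <= (0 : R) <= T by rewrite lexx.
(* The constant [2 + kappa] adds up the bounds of the initial value: [N] for [A u0], [N] for [f] at
   0 and [kappa * N] for the Wick product of [B] with [u0]. *)
have [|||v [cv vE [C C_ge0 vC]]] := @mild_solution_exists R X B b B_bounded b0
  boundB S M w S_semigroup M_gt0 w_gt0 boundS kappa kappa0 N
  (fun alpha => A alpha (u0 alpha) + g0 alpha) fc (2 + kappa) _ N0 bN _ cfc _.
- by rewrite addr_ge0// ltW.
- move=> alpha; rewrite (le_trans (ler_normD _ _))//.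
  rewrite (_ : _ * N alpha = N alpha + (N alpha + kappa * 1 * N alpha)); last by ring.
  rewrite lerD// (le_trans (ler_normD _ _))// lerD//.
    by rewrite (le_trans (f_le _ _ T00)).
  by apply: wick_le => // i; rewrite mul1r.
- move=> alpha t; apply: (@le_trans _ _ (N alpha)).
    by rewrite (le_trans _ (nfN alpha))// f'_le// clamp_itv.
  by rewrite ler_peMl// ler_wpDr ?ler1n// ltW.
pose U alpha t := u0 alpha + primitive (v alpha) t.
pose h alpha s := fc alpha s + wick_op B (v ^~ s) alpha.
have ch alpha : continuous (h alpha).
  move=> t; apply: cvgD; first exact: cfc.
  exact: (continuous_wick_op B_bounded).
have dU alpha t : derivative (U alpha) t (v alpha t).
  rewrite /derivative (_ : diffquo _ t = diffquo (primitive (v alpha)) t).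
    exact: derivative_primitive.
  by apply/funext => k; rewrite /diffquo /U opprD addrACA subrr add0r.
have cU alpha : continuous (U alpha).
  by move=> t; apply: derivative_continuous; exact: dU.
have U0 alpha : U alpha 0 = u0 alpha by rewrite /U primitive0// addr0.
(* Both sides agree at 0, and [h] is the derivative of the right-hand one. *)
have gE alpha t : 0 <= t <= T ->
    g0 alpha + primitive (h alpha) t = f alpha t + wick_op B (U ^~ t) alpha.
  move=> /[dup] tT /andP[t0 _].
  pose G s := f alpha 0 + primitive (fc alpha) s + wick_op B (U ^~ s) alpha.
  have -> : f alpha t + wick_op B (U ^~ t) alpha = G t by rewrite /G -fE.
  rewrite (@primitive_unique R X G (h alpha) t)//.
  - rewrite /G primitive0// addr0; congr (_ + _ + _).
    by rewrite !wick_opE; apply: eq_bigr => i _; rewrite U0.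
  - move=> s; apply: cvgD.
      by apply: cvgD; [exact: cvg_cst|exact: continuous_primitive].
    exact: (continuous_wick_op B_bounded).
  - move=> s _; apply: right_derivativeD.
      rewrite -[fc _ _]add0r; apply: right_derivativeD; first exact: right_derivative_cst.
      exact: right_derivative_primitive.
    apply: (right_derivative_wick_op B_bounded) => beta.
    exact/derivative_right.
(* The second half is the original equation, with [v] as the derivative of [U], solved for [A U]. *)
have DU alpha t : 0 <= t <= T -> D (U alpha t) /\
    A alpha (U alpha t) = v alpha t - (f alpha t + wick_op B (U ^~ t) alpha).
  move=> /[dup] tT /andP[t0 _]; rewrite -gE//.
  apply: (mild_solution_generator (S_semigroup alpha) M_gt0 w_gt0 (boundS alpha)) => //.
  - by have [_ + _] := u0_Dom; apply.
  - by move=> s s0; rewrite vE.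
pose C1 := C * expR (rate M w kappa * T).
have C10 : 0 <= C1 by rewrite mulr_ge0 ?expR_ge0.
have rate0 : 0 < rate M w kappa by rewrite (lt_trans w_gt0)// rate_gt.
have vN alpha t : 0 <= t <= T -> `|v alpha t| <= C1 * N alpha.
  move=> /andP[t0 tT]; rewrite (le_trans (vC _ _ t0))// /C1 mulrAC ler_wpM2r//.
  by rewrite ler_wpM2l// ler_expR ler_wpM2l// ltW.
pose C2 := 1 + C1 * T; have C20 : 0 <= C2 by rewrite addr_ge0// mulr_ge0.
have UN alpha t : 0 <= t <= T -> `|U alpha t| <= C2 * N alpha.
  move=> /andP[t0 tT]; rewrite (le_trans (ler_normD _ _))// /C2 mulrDl mul1r lerD//.
  have := @primitive_lipschitz R X (v alpha) 0 t (C1 * N alpha) t0 (cv alpha).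
  rewrite primitive0// !subr0 => H; apply: le_trans (H _) _.
    by move=> s /andP[s0 st]; rewrite vN// (ltW s0) ltW// (lt_le_trans st).
  by rewrite mulrAC ler_wpM2r// ler_wpM2l.
(* The case [e = 0] is the norm of the conclusion; the cases [e > 0] are the norms of
   [C1_process]. *)
have U_on e : 0 <= e -> e < T ->
    kondratiev (C1_on `[e, T]) (C1_norm `[e, T]) p U.
  move=> e0 eT.
  have eI s : `[e, T]%classic s -> 0 <= s <= T.
    by rewrite /= in_itv/= => /andP[es ->]; rewrite (le_trans e0).
  have eI0 : `[e, T]%classic !=set0 by exists e; rewrite /= in_itv/= lexx ltW.
  apply: (@l2_kondratiev _ _ _ _ _ _ (fun i => (C2 + C1) * N i)); last exact: l2Z.
    by move=> alpha; exact: (C1_on_derivative eT (cv alpha) (dU alpha)).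
  move=> alpha; rewrite adde_ge0 ?sup_norm_ge0//= mulrDl EFinD leeD//.
    by apply: sup_norm_le => t /eI; exact: UN.
  apply: sup_norm_le => t et.
  rewrite (derive_withinE (a := e) (b := T) (d := v alpha t))//.
  - exact/vN/eI.
  - by move=> s /andP[es sT]; rewrite /= in_itv/= !ltW.
have derU alpha t : 0 < t <= T -> derive_within `]0, T] (U alpha) t = v alpha t.
  move=> /andP[t0 tT].
  rewrite (derive_withinE (a := 0) (b := T) (d := v alpha t))// ?(ltW t0)//.
  by move=> s /andP[s0 sT]; rewrite /= in_itv/= s0 ltW.
have U_sol : is_solution T D A B f u0 U.
  split=> //.
  - exists p; first exact: ltW.
    apply: (@l2_kondratiev _ _ _ _ _ _ (fun i => C2 * N i)); last exact: l2Z.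
      by move=> alpha; apply: continuous_subspaceT; exact: cU.
    move=> alpha; rewrite sup_norm_ge0//=; apply: sup_norm_le => t.
    by rewrite /= in_itv; exact: UN.
  - by exists p; [exact: ltW|move=> e e0 eT; apply: U_on => //; exact: ltW].
  - move=> t /andP[/ltW t0 tT]; have tI : 0 <= t <= T by rewrite t0.
    split.
    + exists p; first exact: ltW.
      apply: (@l2_kondratiev _ _ _ _ _ _ (fun i => C2 * N i)); last exact: l2Z.
        by [].
      by move=> alpha; rewrite !lee_fin normr_ge0 UN.
    + by move=> alpha; have [] := DU alpha t tI.
    + exists p => //.
      apply: (@l2_kondratiev _ _ _ _ _ _
        (fun i => (C1 + (1 + kappa * C2)) * N i)); last exact: l2Z.
        by [].
      move=> alpha; rewrite !lee_fin normr_ge0 /coord_op.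
      have [_ ->] := DU alpha t tI.
      rewrite (le_trans (ler_normB _ _))// mulrDl lerD ?vN//.
      rewrite (le_trans (ler_normD _ _))// mulrDl mul1r lerD//.
        by rewrite (le_trans (f_le _ _ tI)).
      by apply: wick_le => // i; exact: UN.
  - move=> t /[dup] tI /andP[/ltW t0 tT] alpha; rewrite derU//.
    have [|_ +] := DU alpha t; first by rewrite t0.
    by rewrite /coord_op => ->; rewrite -addrA [wick_op _ _ _ + f _ _]addrC subrK.
exists U; split; [exact: U_on|exact: U_sol|].
move=> V [[q q0 V_C0] [q' q'0 V_C1] V0 V_Dom VE] alpha t tT; apply/eqP.
rewrite -subr_eq0; apply/eqP.
have [V_on _] := V_C0.
have supV0 i : (0 <= sup_norm `[0%R, T] (V i))%E by exact: sup_norm_ge0.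
have [Vfin l2V] := kondratiev_l2 supV0 V_C0.
(* [V] may belong to another exponent [q]. The weights decrease as the exponent grows, so the bounds
   on [b], [N] and the norms of [V] all persist at [max p q]. *)
pose r := Num.max p q.
pose nV i := fine (sup_norm `[0, T] (V i)).
have nV0 i : 0 <= nV i by exact: fine_ge0.
have Vle i s : 0 <= s <= T -> `|V i s| <= nV i.
  by move=> /itvT sT; rewrite -lee_fin fineK//; exact: le_sup_norm.
have bKr : sums_le (fun i => b i * weight (- r / 2) i) K.
  move=> s us; apply: le_trans (bK s us); apply: ler_sum => i _.
  rewrite ler_wpM2l// weight_le// ler_wpM2r// lerN2.
  by rewrite le_max lexx.
(* The new majorant dominates the sum of the bounds on both solutions, hence their difference
   [W]. *)
have [||N' _ N'P] := @l2_supersolution R r b K K0 b0 bKr (fun i => nV i + C2 * N i).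
- by move=> i; rewrite addr_ge0// mulr_ge0.
- apply: l2D; first by apply: l2_exponent_le l2V; rewrite le_max lexx orbT.
  by apply: l2_exponent_le (l2Z C2 l2N); rewrite le_max lexx.
pose W i s := V i (clamp T s) - U i (clamp T s).
suff : W alpha t = 0 by rewrite /W clampE.
apply: (@homogeneous_solution_eq0 R X B b b0 boundB S M w S_semigroup M_gt0
  w_gt0 boundS kappa kappa0 N' W T _ _ _ _ _ alpha t tT); rewrite /W.
- by move=> i; have [] := N'P i.
- move=> i s; apply: cvgB; first by apply: continuous_comp_clamp => //; exact: V_on.
  apply: (@continuous_comp _ _ _ (clamp T)); [exact: continuous_clamp|exact: cU].
- by move=> i; rewrite clampE// V0 U0 subrr.
- move=> i s sT; rewrite clampE// (le_trans (ler_normB _ _))//.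
  by have [N'i _] := N'P i; rewrite (le_trans _ N'i)// lerD ?Vle ?UN.
move=> i s /andP[s0 sT]; have sI : 0 < s <= T by rewrite s0 ltW.
have sI' : 0 <= s <= T by rewrite !ltW.
have sI'' : 0 <= s < T by rewrite ltW.
pose V' := derive_within `]0, T] (V i) s.
(* [V] is C^1 on [[s / 2, T]], while the equation uses the derivative within []0, T]]. For
   increments smaller than [s / 2] the two intervals admit the same points, so the derivatives
   agree. *)
have dV : right_derivative (V i) s V'.
  have [V_on' _] := V_C1 (s / 2) ltac:(by rewrite divr_gt0) ltac:(lra).
  have [_ /(_ s) + _] := V_on' i.
  have si : `[s / 2, T]%classic s by rewrite /= in_itv/=; lra.
  move=> /(_ si) dV.
  have dV0 : diffquo (V i) s k @[k --> within [set k | `]0, T]%classic (s + k)] 0^'] -->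
      derive_within `[s / 2, T] (V i) s.
    apply: cvg_trans dV; apply: cvg_app => Z [e /= e0 HZ].
    exists (Num.min e (s / 2)) => /=; first by rewrite lt_min e0 divr_gt0.
    move=> k /=; rewrite sub0r normrN lt_min => /andP[ke ks] k0.
    rewrite in_itv/= => /andP[sk0 skT].
    apply: HZ => //=; first by rewrite sub0r normrN.
    by rewrite in_itv/= skT andbT; move: ks; rewrite ltr_norml; lra.
  have PF : ProperFilter (within [set k | `]0, T]%classic (s + k)] 0^').
    apply: (@proper_within_interval _ _ 0 T) => //.
    by move=> k /andP[k0 kT]; rewrite /= in_itv/= k0 ltW.
  apply: (right_derivative_within sT _ (I := `]0, T]%classic)).
    by move=> k /andP[sk kT]; rewrite /= in_itv/= ltW// (lt_trans s0).
  rewrite /V' /derive_within (cvg_lim _ dV0)//; exact: norm_hausdorff.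
have [_ DV _] := V_Dom s sI.
have VEi := VE s sI i; rewrite -/V' in VEi.
(* The witnesses are the right derivative of [W] and the generator applied to [W]; subtracting the
   two equations cancels [f] and leaves the Wick term. *)
exists (V' - v i s), (A i (V i s) - A i (U i s)); rewrite clampE//; split.
- apply: right_derivativeB; apply: right_derivative_comp_clamp => //.
  exact/derivative_right.
- rewrite (_ : S i ^~ (V i s - U i s) =
    fun k => S i k (V i s) - S i k (U i s)); last first.
    by apply/funext => k; rewrite linearB.
  have [DUs _] := DU i s sI'.
  by apply: right_derivativeB;
    apply/(generator_right_derivative (S_semigroup i) _ _ (A_generator i)).
- have [_ ->] := DU i s sI'.
  rewrite wick_opB VEi /coord_op opprB addrA [_ + (v i s - _)]addrA subrK.
  by rewrite opprD addrA addrK [A i _ + _]addrC [_ + A i _ - _]addrAC addrK.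
Qed.
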